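(* There exists a non-zero $t\in K_-$ such that the complex structure $I_{X\times\hat X}$ of $X\times\hat X$ belongs to the period domain $\Omega_{B,t}$. Furthermore, the polarized abelian variety of Weil type $(X\times\hat X,\eta,\Xi_t)$ is of split type.
   Context: $K$ is a CM-field, $F$ its maximal totally real subfield, $\iota$ the generator of $\mathrm{Gal}(K/F)$, $K_-=\{t\in K:\iota(t)=-t\}$, $e=[K:\mathbb Q]$, $\Sigma$ the set of embeddings $K\to\mathbb C$, $\hat\Sigma$ the set of embeddings $F\to\mathbb R$. A CM-type is a map $T:\hat\Sigma\to\Sigma$ with $T(\hat\sigma)|_F=\hat\sigma$. $d$ is a positive even integer, $X$ is a simple complex abelian variety of dimension $n=de/4$ with an isomorphism $\hat\eta:F\to\mathrm{End}_{\mathbb Q}(X)$, so $\dim_FH^1(X,\mathbb Q)=d$; $\hat X$ is the dual abelian variety. $V=H^1(X,\mathbb Z)\oplus H^1(\hat X,\mathbb Z)=H^1(X\times\hat X,\mathbb Z)$, with $H^1(\hat X,\mathbb Z)=H^1(X,\mathbb Z)^*$ and pairing $((w_1,\theta_1),(w_2,\theta_2))_V=\theta_1(w_2)+\theta_2(w_1)$; $V_L=V\otimes_{\mathbb Z}L$. $F$ acts on $V_{\mathbb Q}$ via $\hat\eta$, acting on $H^1(\hat X,\mathbb Q)$ by $\theta\mapsto\theta\circ\hat\eta(a)$; $(\cdot,\cdot)_{V_{\hat\eta}}$ is the unique $F$-valued symmetric $F$-bilinear form on $V_{\mathbb Q}$ with $\mathrm{tr}_{F/\mathbb Q}\circ(\cdot,\cdot)_{V_{\hat\eta}}=(\cdot,\cdot)_V$.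 $\wedge^2_FH^1(X,\mathbb Q)\subset\wedge^2_{\mathbb Q}H^1(X,\mathbb Q)$ is the subspace of classes which, as alternating forms on $H_1(X,\mathbb Q)$, satisfy $\gamma(ax,y)=\gamma(x,ay)$ for $a\in F$; under the present assumptions it contains $H^{1,1}(X,\mathbb Q)$. Fix a polarization $\Theta\in H^{1,1}(X,\mathbb Q)$ and $q\in F$ with $K=F(\sqrt{-q})$, $\sqrt{-q}\in K_-$. Let $W=\{-(\Theta\rfloor\xi)\sqrt{-q}+\xi:\xi\in H^1(\hat X,\mathbb Q)\otimes_FK\}\subset V_{\mathbb Q}\otimes_FK$, where $\Theta\rfloor:H^1(X,\mathbb Q)^*\to H^1(X,\mathbb Q)$ is contraction, extended $K$-linearly. With $\iota$ acting on the second factor, $W\cap\iota(W)=0$ and $V_{\mathbb Q}=\{w+\iota(w):w\in W\}$; $\eta:K\to\mathrm{End}_{\mathbb Q}(V_{\mathbb Q})$ is $\eta(t)(w+\iota(w))=tw+\iota(tw)$. $V_\sigma\subset V_{\mathbb C}$ is the ($d$-dimensional) subspace on which $\eta(t)$ acts by $\sigma(t)$ for all $t\in K$. Write $\Theta=\sum_{\hat\sigma}\Theta_{\hat\sigma}$ with $\Theta_{\hat\sigma}\in\wedge^2H^1_{\hat\sigma}(X)$, $H^1_{\hat\sigma}(X)\subset H^1(X,\mathbb R)$ the subspace on which $F$ acts via $\hat\sigma$. $B\subset H^{ev}(X,\mathbb Q)$ is the rational subspace such that $B\otimes\mathbb C$ is spanned by the pure spinors $\exp\left(\sum_{\hat\sigma}T(\hat\sigma)(\sqrt{-q})\Theta_{\hat\sigma}\right)$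 of $\bigoplus_{\hat\sigma}V_{T(\hat\sigma)}$, $T$ a CM-type. $\mathrm{Spin}(V_{\mathbb R})_B$ is the subgroup of $\mathrm{Spin}(V_{\mathbb R})$ acting trivially on $B$ under the spin representation on $H^*(X,\mathbb R)$ (in which $(w,\theta)\in V$ acts by $s\mapsto w\wedge s+\theta\rfloor s$), and $\rho$ is the vector representation. For $0\ne t\in K_-$, $\Xi_t(x,y)=(\eta(t)x,y)_V$ and $\Omega_{B,t}$ is the set of $I\in\rho(\mathrm{Spin}(V_{\mathbb R})_B)$ with $I^2=-1$, with both eigenspaces of $I$ on each $V_\sigma$ of dimension $d/2$, and with $\Xi_t(x,I(y))$ positive definite. Split type: let $V_\eta$ be $V_{\mathbb Q}$ as a $K$-vector space via $\eta$, and $H_t(x,y)=(-t^2)(x,y)_{V_{\hat\eta}}+t(\eta(t)x,y)_{V_{\hat\eta}}$, a $K$-valued hermitian form. $(X\times\hat X,\eta,\Xi_t)$ is of split type if $(V_\eta,H_t)$ has a totally isotropic $K$-subspace of dimension $d/2$; equivalently, $H_t$ has signature $(d/2,d/2)$ at every $\hat\sigma\in\hat\Sigma$ and discriminant $(-1)^{d/2}$ in $F^\times/Nm_{K/F}(K^\times)$. *)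

(* Defs.v *)
From HB Require Import structures.
From mathcomp Require Import all_boot all_order all_algebra all_field.
From mathcomp Require Import reals complex.
Set Implicit Arguments.
Unset Strict Implicit.
Unset Printing Implicit Defensive.
Import Order.TTheory GRing.Theory Num.Theory.
Local Open Scope ring_scope.

(** * Number fields *)

Definition field_trace (L : fieldExtType rat) (a : L) : rat :=
  \sum_i coord (vbasis {:L}) i (a * (vbasis {:L})`_i).

Definition totally_real (R : realType) (L : fieldExtType rat) : Prop :=
  forall (s : {rmorphism L -> R[i]}) (x : L), complex.Im (s x) = 0.

Definition totally_imaginary (R : realType) (L : fieldExtType rat) : Prop :=
  forall s : {rmorphism L -> R[i]}, exists x : L, complex.Im (s x) <> 0.

(* Such an [F] is automatically the largest totally real subfield of [K]. *)
Definition is_CM (R : realType) (K : fieldExtType rat) (F : {subfield K})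
    (iota : {rmorphism K -> K}) : Prop :=
  [/\ totally_real R (subvs_of F), totally_imaginary R K, \dim_F {:K} = 2,
      forall a, a \in F -> iota a = a & exists x, iota x <> x].

(* {rmorphism L -> R} carries no finType structure, so sums over the embeddings
   L -> R are indexed by an enumeration without repetition. *)
Definition enumerates_embeddings (R : realType) (L : fieldExtType rat) (h : nat)
    (s : 'I_h -> {rmorphism L -> R}) : Prop :=
  (forall i j, s i =1 s j -> i = j) /\
  (forall f : {rmorphism L -> R}, exists i, s i =1 f).

Definition CM_type (R : realType) (K : fieldExtType rat) (F : {subfield K})
    (h : nat) (s : 'I_h -> {rmorphism subvs_of F -> R})
    (T : 'I_h -> {rmorphism K -> R[i]}) : Prop :=
  forall i (a : subvs_of F), T i (vsval a) = real_complex R (s i a).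

(** * Complex abelian varieties *)

(* [Theta] is the Gram matrix of a rational alternating form on
   H_1(X, Q) = 'cV[rat]_m; [J] is the complex structure of H_1(X, R). *)
Definition is_polarization (R : realType) (m : nat) (J : 'M[R]_m)
    (Theta : 'M[rat]_m) : Prop :=
  let E := map_mx ratr Theta : 'M[R]_m in
  [/\ Theta^T = - Theta, J^T *m E *m J = E
    & forall x : 'cV[R]_m, x != 0 -> 0 < (x^T *m E *m (J *m x)) 0 0].

(* The torus X = H_1(X, R) / H_1(X, Z) with H_1(X, Z) = 'cV[int]_(2n), where
   H_1(X, R) = 'cV[R]_(2n) is a complex vector space through [cx_str]. *)
Record abelian_variety (R : realType) (n : nat) := AbelianVariety {
  cx_str : 'M[R]_(n.*2);
  cx_str_sqr : cx_str *m cx_str = - 1%:M;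
  polarizable : exists Theta, is_polarization cx_str Theta
}.

(* Abelian subvarieties correspond to rational subspaces of H_1(X, Q) (here, the
   column space of [U]) whose realification is stable under the complex
   structure. *)
Definition is_simple (R : realType) (n : nat) (X : abelian_variety R n) : Prop :=
  (0 < n)%N /\
  forall k (U : 'M[rat]_(n.*2, k)),
    (exists A : 'M[R]_k, cx_str X *m map_mx ratr U = map_mx ratr U *m A) ->
    U = 0 \/ \rank U = n.*2.

(* Elements of End_Q(X), by their action on H_1(X, Q). *)
Definition is_Qendo (R : realType) (n : nat) (X : abelian_variety R n)
    (M : 'M[rat]_(n.*2)) : Prop :=
  map_mx ratr M *m cx_str X = cx_str X *m map_mx ratr M.

(** * The lattice V = H^1(X) (+) H^1(X^) *)

(* An element of V_L is [col_mx w theta]: [w] is in H^1(X, L), in coordinates dual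
   to those of H_1(X, L), and [theta] is in H^1(X^, L) = H^1(X, L)^* = H_1(X, L). *)
Definition pairV (L : comPzRingType) (m : nat) (x y : 'cV[L]_(m + m)) : L :=
  ((dsubmx x)^T *m usubmx y + (dsubmx y)^T *m usubmx x) 0 0.

(* The action on V of an endomorphism of X acting on H_1(X) by [M]. *)
Definition actV (L : pzRingType) (m : nat) (M : 'M[L]_m) : 'M[L]_(m + m) :=
  block_mx M^T 0 0 M.

(* Multiplication by i on the tangent space H^1(X, R) ~ H^{0,1}(X) of
   X^ = Pic^0(X) is minus the transpose of the complex structure of X, whence
   the sign on H^1(X^, R). *)
Definition cx_XXdual (R : realType) (n : nat) (X : abelian_variety R n) :
    'M[R]_(n.*2 + n.*2) :=
  block_mx (cx_str X)^T 0 0 (- cx_str X).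

Definition is_Fform (K : fieldExtType rat) (F : {subfield K}) (m : nat)
    (etahat : subvs_of F -> 'M[rat]_m)
    (bF : 'cV[rat]_(m + m) -> 'cV[rat]_(m + m) -> subvs_of F) : Prop :=
  [/\ forall x y, bF x y = bF y x,
      forall a x y z,
        bF (actV (etahat a) *m x + y) z = a * bF x z + bF y z
    & forall x y, field_trace (bF x y) = pairV x y].

(** * The action of K on V_Q *)

(* V_Q (x)_F K for K = F (+) F r with r ^+ 2 = - q: the pair (x, y) stands for
   x (x) 1 + y (x) r. *)
Section TensorK.
Variables (K : fieldExtType rat) (F : {subfield K}) (m : nat).
Variables (etahat : subvs_of F -> 'M[rat]_m) (q : subvs_of F).
Let VK : Type := ('cV[rat]_(m + m) * 'cV[rat]_(m + m))%type.

(* multiplication by a + b r *)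
Definition scaleVK (a b : subvs_of F) (z : VK) : VK :=
  (actV (etahat a) *m z.1 - actV (etahat (q * b)) *m z.2,
   actV (etahat b) *m z.1 + actV (etahat a) *m z.2).

Definition iotaVK (z : VK) : VK := (z.1, - z.2).

(* Theta _| xi = Theta (xi, -) *)
Definition contractTheta (Theta : 'M[rat]_m) (xi : 'cV[rat]_m) : 'cV[rat]_m :=
  Theta^T *m xi.

Definition in_W (Theta : 'M[rat]_m) (z : VK) : Prop :=
  exists xi0 xi1 : 'cV[rat]_m,
    z = - scaleVK 0 1 (col_mx (contractTheta Theta xi0) 0,
                       col_mx (contractTheta Theta xi1) 0)
        + (col_mx 0 xi0, col_mx 0 xi1).

Definition is_eta (Theta : 'M[rat]_m) (r : K)
    (eta : K -> 'M[rat]_(m + m)) : Prop :=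
  forall (a b : subvs_of F) (w : VK), in_W Theta w ->
    (eta (vsval a + vsval b * r) *m (w + iotaVK w).1, 0)
    = scaleVK a b w + iotaVK (scaleVK a b w).
End TensorK.

(** * The exterior algebra H^*(X, L) *)

(* [s A] is the coefficient of the increasing wedge product of the e_i, i in A. *)
Notation ext L m := {ffun {set 'I_m} -> L^o}.

Section Exterior.
Variables (L : fieldType) (m : nat).
Implicit Types (s t : ext L m) (A B : {set 'I_m}).

Definition inversions A B : nat :=
  #|[set p : 'I_m * 'I_m | [&& p.1 \in A, p.2 \in B & (p.2 < p.1)%N]]|.

Definition ext_basis A : ext L m := [ffun B : {set 'I_m} => (B == A)%:R].

Definition wedge s t : ext L m :=
  [ffun A : {set 'I_m} => \sum_(B : {set 'I_m} | B \subset A)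
               (-1) ^+ inversions B (A :\: B) * s B * t (A :\: B)].

Definition ext1 (w : 'cV[L]_m) : ext L m := \sum_i w i 0 *: ext_basis [set i].

Definition ext2 (E : 'M[L]_m) : ext L m :=
  \sum_(i < m) \sum_(j < m | (i < j)%N)
    E i j *: wedge (ext_basis [set i]) (ext_basis [set j]).

(* The antiderivation w |-> theta(w) of degree -1. *)
Definition contract (theta : 'cV[L]_m) s : ext L m :=
  [ffun A : {set 'I_m} => \sum_(i | i \notin A)
               (-1) ^+ inversions [set i] A * theta i 0 * s (i |: A)].

Definition ext_exp s : ext L m :=
  \sum_(k < m.+1) (k`!%:R)^-1 *: iter k (wedge s) (ext_basis set0).

Definition has_parity (b : bool) s : Prop :=
  forall A, odd #|A| != b -> s A = 0.

(* The action of V_L on the spin representation H^*(X, L). *)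
Definition spin_act (v : 'cV[L]_(m + m)) : 'End(ext L m) :=
  linfun (fun s => wedge (ext1 (usubmx v)) s + contract (dsubmx v) s).
End Exterior.

Definition map_ext (L L' : fieldType) (f : L -> L') (m : nat) (s : ext L m) :
    ext L' m := [ffun A : {set 'I_m} => f (s A)].

(** * Spin(V) *)

(* As H^1(X) and H^1(X^) are complementary maximal isotropic subspaces of V_L,
   the spin representation identifies the Clifford algebra C(V_L), with relation
   v . v = (v, v) / 2, with End(H^*(X, L)); its even part consists of the
   endomorphisms preserving parity. *)
Section Spin.
Variables (L : fieldType) (m : nat).

Definition main_antiautomorphism (tau : 'End(ext L m) -> 'End(ext L m)) : Prop :=
  [/\ linear tau,
      forall f g, tau (f \o g)%VF = (tau g \o tau f)%VF
    & forall v : 'cV[L]_(m + m), tau (spin_act v) = spin_act v].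

(* [is_spin g A]: g is in Spin(V_L) and rho(g) = A, that is,
   g tau(g) = 1 and g . v . tau(g) = A v for all v. *)
Definition is_spin (g : 'End(ext L m)) (A : 'M[L]_(m + m)) : Prop :=
  (forall b s, has_parity b s -> has_parity b (g s)) /\
  exists2 tau, main_antiautomorphism tau &
    (g \o tau g)%VF = \1%VF /\
    forall v, (g \o spin_act v \o tau g)%VF = spin_act (A *m v).
End Spin.

(* rho(Spin(V_R)_B) *)
Definition in_rho_Spin_B (R : realType) (m : nat) (B : {vspace ext rat m})
    (A : 'M[R]_(m + m)) : Prop :=
  exists2 g, is_spin g A &
    forall b, b \in B -> g (map_ext ratr b) = map_ext ratr b.

(** * The components of Theta and the subspace B *)

(* H^1_{s}(X) for an embedding s : F -> R *)
Definition in_H1 (R : realType) (K : fieldExtType rat) (F : {subfield K})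
    (m : nat) (etahat : subvs_of F -> 'M[rat]_m)
    (s : {rmorphism subvs_of F -> R}) (w : 'cV[R]_m) : Prop :=
  forall a, (map_mx ratr (etahat a))^T *m w = s a *: w.

Definition in_wedge2 (L : fieldType) (m : nat) (P : 'cV[L]_m -> Prop)
    (z : ext L m) : Prop :=
  exists (k : nat) (u v : 'I_k -> 'cV[L]_m),
    (forall i, P (u i) /\ P (v i)) /\
    z = \sum_i wedge (ext1 (u i)) (ext1 (v i)).

Definition is_decomposition (R : realType) (K : fieldExtType rat)
    (F : {subfield K}) (m : nat) (etahat : subvs_of F -> 'M[rat]_m)
    (Theta : 'M[rat]_m) (h : nat) (s : 'I_h -> {rmorphism subvs_of F -> R})
    (Thetas : 'I_h -> ext R m) : Prop :=
  (forall i, in_wedge2 (in_H1 etahat (s i)) (Thetas i)) /\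
  ext2 (map_mx ratr Theta) = \sum_i Thetas i.

Definition pure_spinor (R : realType) (K : fieldExtType rat) (m h : nat) (r : K)
    (Thetas : 'I_h -> ext R m) (T : 'I_h -> {rmorphism K -> R[i]}) :
    ext R[i] m :=
  ext_exp (\sum_i T i r *: map_ext (real_complex R) (Thetas i)).

Definition is_B (R : realType) (K : fieldExtType rat) (F : {subfield K})
    (m h : nat) (r : K) (s : 'I_h -> {rmorphism subvs_of F -> R})
    (Thetas : 'I_h -> ext R m) (B : {vspace ext rat m}) : Prop :=
  let BC : {vspace ext R[i] m} :=
    <<[seq map_ext ratr (b : ext rat m) | b <- vbasis B]>>%VS in
  [/\ forall b, b \in B -> has_parity false b,
      forall T, CM_type s T -> pure_spinor r Thetas T \in BC
    & forall U : {vspace ext R[i] m},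
        (forall T, CM_type s T -> pure_spinor r Thetas T \in U) ->
        (BC <= U)%VS].

(** * Period domain, Weil type, split type *)

Definition has_dim (L : fieldType) (E : vectType L) (P : E -> Prop) (k : nat) :
    Prop :=
  exists2 U : {vspace E}, (forall x, x \in U <-> P x) & \dim U = k.

Section PeriodDomain.
Variables (R : realType) (K : fieldExtType rat) (m : nat).
Variable eta : K -> 'M[rat]_(m + m).

Definition in_Vsigma (sigma : {rmorphism K -> R[i]}) (v : 'cV[R[i]]_(m + m)) :
    Prop :=
  forall t, map_mx ratr (eta t) *m v = sigma t *: v.

Definition balanced_eigenspaces (d : nat) (I : 'M[R]_(m + m)) : Prop :=
  forall sigma : {rmorphism K -> R[i]},
    has_dim (fun v => in_Vsigma sigma v /\
      map_mx (real_complex R) I *m v = (Complex 0 1 : R[i]) *: v) d./2 /\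
    has_dim (fun v => in_Vsigma sigma v /\
      map_mx (real_complex R) I *m v = - (Complex 0 1 : R[i]) *: v) d./2.

Definition Xi (L : numFieldType) (t : K) (x y : 'cV[L]_(m + m)) : L :=
  pairV (map_mx ratr (eta t) *m x) y.

Definition Xi_positive (t : K) (I : 'M[R]_(m + m)) : Prop :=
  (forall x y, Xi t x (I *m y) = Xi t y (I *m x)) /\
  (forall x : 'cV[R]_(m + m), x != 0 -> 0 < Xi t x (I *m x)).

Definition in_Omega (d : nat) (B : {vspace ext rat m}) (t : K)
    (I : 'M[R]_(m + m)) : Prop :=
  [/\ in_rho_Spin_B B I, I *m I = - 1%:M, balanced_eigenspaces d I
    & Xi_positive t I].

(* For the complex structure [I] on H^1(A, R), A = X x X^: [eta] takes values in
   End_Q(A) with balanced multiplicities, and Xi_t is a polarization whose Rosati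
   involution restricts to iota on K. *)
Definition polarized_Weil_type (iota : K -> K) (d : nat) (t : K)
    (I : 'M[R]_(m + m)) : Prop :=
  [/\ forall a, map_mx ratr (eta a) *m I = I *m map_mx ratr (eta a),
      balanced_eigenspaces d I,
      forall x y : 'cV[rat]_(m + m), Xi t x y = - Xi t y x,
      (forall x y, Xi t (I *m x) (I *m y) = Xi t x y) /\ Xi_positive t I
    & forall a (x y : 'cV[rat]_(m + m)),
        Xi t (eta a *m x) y = Xi t x (eta (iota a) *m y)].

Definition Hform (F : {subfield K})
    (bF : 'cV[rat]_(m + m) -> 'cV[rat]_(m + m) -> subvs_of F) (t : K)
    (x y : 'cV[rat]_(m + m)) : K :=
  - t ^+ 2 * vsval (bF x y) + t * vsval (bF (eta t *m x) y).

Definition Kcomb (k : nat) (u : 'I_k -> 'cV[rat]_(m + m)) (c : 'I_k -> K) :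
    'cV[rat]_(m + m) := \sum_i eta (c i) *m u i.

(* The subspace is given by a K-basis [u]. *)
Definition split_type (F : {subfield K})
    (bF : 'cV[rat]_(m + m) -> 'cV[rat]_(m + m) -> subvs_of F) (d : nat) (t : K) :
    Prop :=
  exists2 u : 'I_(d./2) -> 'cV[rat]_(m + m),
    (forall c, Kcomb u c = 0 -> forall i, c i = 0) &
    (forall c c', Hform bF t (Kcomb u c) (Kcomb u c') = 0).
End PeriodDomain.

(* Main.v *)
Require Import Defs.
From HB Require Import structures.
From mathcomp Require Import all_boot all_order all_algebra all_field.
From mathcomp Require Import reals complex ring.
Set Implicit Arguments.
Unset Strict Implicit.
Unset Printing Implicit Defensive.
Import Order.TTheory GRing.Theory Num.Theory.
Local Open Scope ring_scope.

(** Write E for the Gram matrix of Theta, M_a for the action of a in F on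
    H_1(X, Q), and J for the complex structure of H_1(X, R).  The theorem holds
    with t := - r, where r is the chosen square root of - q.

    Shape of eta.  The Rosati involution of Theta restricts to a positive
    involution of the totally real field F, hence is trivial: M_a^T E = E M_a
    ([rosati_trivial]).  Therefore eta (a + b r) = actV M_a + actV M_b N with
    N = [0, - M_q^T E; E^-1, 0] ([etaE]), and all the algebraic conditions on eta,
    Xi_t and the complex structure I = diag(J^T, - J) become block matrix
    identities.  The Gram matrix of Xi_(-r) (x, I y) is
    diag(E^-1 J^T, E J M_q).  Up to the change of variables w = E u its first
    block is the positive form E J; the second is positive because every
    eigenvalue of the self-adjoint operator M_q is a conjugate of q and q is
    totally positive, K = F (sqrt (- q)) being totally imaginary ([Xq_pos]).

    Membership in rho (Spin (V_R)_B).  The algebra endomorphism g = ext_map J^T of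
    H^*(X, R) induced by J^T satisfies g . v = (I v) . g for v in V.  It fixes
    Theta because J preserves E, then each component of Theta because J commutes
    with F and the component decomposition is unique ([ext_map_component]), then
    every pure spinor exp (sum_i T_i(r) Theta_i), hence B ([ext_map_B]).
    It remains to see that g has spinor norm g tau(g) = 1.  By irreducibility
    of the spin representation g tau(g) is a scalar, multiplicative in J^T.  As J^T is the
    square of (1 + J^T) / sqrt 2, the scalar is a square, hence nonnegative; as
    (J^T)^2 = - 1 has spinor norm 1 in even rank, it is also a square root of 1
    ([spinor_norm_complex_structure]).

    Eigenspaces.  An F-basis of H_1(X, Q) yields a frame of the sigma-component of
    H^1(X, C) whose matrix has real entries, F being totally real
    ([character_frame]).  On that component J^T is a real d x d matrix of square
    - 1, so its eigenspaces for i and - i are exchanged by conjugation and both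
    have dimension d / 2; the projection to H^1(X, C) identifies them with the
    eigenspaces of I on V_sigma ([eigenspace_dim]).

    Split type.  Since Theta is skew and satisfies M_a^T E = E M_a, H_1(X, Q)
    contains an F-Lagrangian subspace U ([exists_isotropic]).  Placed in H^1(X^, Q), it generates over K the
    subspace of pairs (E u, u') with u, u' in U, which is isotropic for the pairing
    of V; being K-stable it is isotropic for the F-valued form by
    nondegeneracy of the trace, and so for H_t. *)

(** * Signs and the exterior algebra *)

Section Signs.
Variable m : nat.
Implicit Types (A B C : {set 'I_m}) (i j : 'I_m).

Lemma inversions_sum A B :
  inversions A B = (\sum_(i in A) \sum_(j in B) (j < i))%N.
Proof.
rewrite /inversions -sum1_card pair_big_dep /= big_mkcond [RHS]big_mkcond /=.
apply: eq_bigr => -[i j] _ /=; rewrite inE /=.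
by case: (i \in A); case: (j \in B); case: (j < i)%N.
Qed.

Lemma sumn_setU (f : 'I_m -> nat) A B : [disjoint A & B] ->
  (\sum_(i in A :|: B) f i = \sum_(i in A) f i + \sum_(i in B) f i)%N.
Proof. by move=> dAB; rewrite -bigU //; apply: eq_bigl => i; rewrite !inE. Qed.

Lemma inversionsUl A B C : [disjoint A & B] ->
  inversions (A :|: B) C = (inversions A C + inversions B C)%N.
Proof. by move=> dAB; rewrite !inversions_sum sumn_setU. Qed.

Lemma inversionsUr A B C : [disjoint A & B] ->
  inversions C (A :|: B) = (inversions C A + inversions C B)%N.
Proof.
move=> dAB; rewrite !inversions_sum -big_split /=.
by apply: eq_bigr => i _; rewrite sumn_setU.
Qed.

Lemma inversions11 i j : inversions [set i] [set j] = (j < i)%N.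
Proof. by rewrite inversions_sum !big_set1. Qed.

Lemma inversions0l B : inversions set0 B = 0%N.
Proof. by rewrite inversions_sum big_set0. Qed.

Lemma disjoint1D i A : i \notin A -> [disjoint [set i] & A].
Proof. by rewrite disjoints1. Qed.

Variable L : pzRingType.

(** The sign in e_i /\ e_A = esgn i A e_(i |: A), for i outside A. *)
Definition esgn i A : L := (-1) ^+ inversions [set i] A.

Lemma esgnU1 i j A : j \notin A -> esgn i (j |: A) = (-1) ^+ (j < i)%N * esgn i A.
Proof.
by move=> jA; rewrite /esgn inversionsUr ?disjoint1D // inversions11 exprD.
Qed.

Lemma esgnU i A B : [disjoint A & B] ->
  esgn i (A :|: B) = esgn i A * esgn i B.
Proof. by move=> dAB; rewrite /esgn inversionsUr // exprD. Qed.

Lemma esgn_swap i j A : i != j -> i \notin A -> j \notin A ->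
  esgn i (j |: A) * esgn j A = - (esgn j (i |: A) * esgn i A).
Proof.
move=> ij iA jA; rewrite !esgnU1 //.
have C : esgn i A * esgn j A = esgn j A * esgn i A.
  by rewrite /esgn -!exprD addnC.
rewrite -!mulrA C -mulNr; congr (_ * _).
by case: ltngtP ij => // [|/ord_inj ->]; rewrite ?eqxx // expr0 ?opprK.
Qed.

(** This sign is the reason why creation by e_j and annihilation by e_i
    anticommute for i != j. *)
Lemma esgn_swapC i j A : i != j -> i \notin A -> j \notin A ->
  esgn i (j |: A) * esgn j (i |: A) = - (esgn i A * esgn j A).
Proof.
move=> ij iA jA; rewrite !esgnU1 //.
have C : esgn i A * (-1) ^+ (i < j)%N = (-1) ^+ (i < j)%N * esgn i A.
  by rewrite /esgn -!exprD addnC.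
rewrite mulrA -(mulrA _ (esgn i A)) C !mulrA -mulNr -[- esgn i A]mulN1r; congr (_ * _ * _).
case: ltngtP ij => // [||/ord_inj ->]; rewrite ?eqxx // => _ _ /=.
  by rewrite ?expr0 ?expr1 ?mul1r ?mulr1.
by rewrite ?expr0 ?expr1 ?mul1r ?mulr1.
Qed.

Lemma esgn_sqr i A : esgn i A * esgn i A = 1.
Proof. by rewrite /esgn -exprD addnn -signr_odd odd_double. Qed.
End Signs.

Section Exterior.
Variables (L : numFieldType) (m : nat).
Implicit Types (s t : ext L m) (A B : {set 'I_m}) (i j : 'I_m).
Implicit Types (v w th : 'cV[L]_m).

Local Notation "1e" := (ext_basis L set0) (at level 0).

Lemma wedgeDl s s' t : wedge (s + s') t = wedge s t + wedge s' t.
Proof.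
apply/ffunP=> A; rewrite !ffunE -big_split; apply: eq_bigr => B _ /=.
by rewrite !ffunE mulrDr mulrDl.
Qed.

Lemma wedgeDr s t t' : wedge s (t + t') = wedge s t + wedge s t'.
Proof.
apply/ffunP=> A; rewrite !ffunE -big_split; apply: eq_bigr => B _ /=.
by rewrite !ffunE mulrDr.
Qed.

Lemma wedgeZl (a : L) s t : wedge (a *: s) t = a *: wedge s t.
Proof.
apply/ffunP=> A; rewrite !ffunE scaler_sumr; apply: eq_bigr => B _ /=.
by rewrite !ffunE /GRing.scale /= mulrCA !mulrA.
Qed.

Lemma wedgeZr (a : L) s t : wedge s (a *: t) = a *: wedge s t.
Proof.
apply/ffunP=> A; rewrite !ffunE scaler_sumr; apply: eq_bigr => B _ /=.
by rewrite !ffunE /GRing.scale /= mulrCA !mulrA.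
Qed.

Fact wedge_is_linear s : linear (wedge s).
Proof. by move=> a t t'; rewrite wedgeDr wedgeZr. Qed.
HB.instance Definition _ s :=
  GRing.isLinear.Build L (ext L m) (ext L m) *:%R (wedge s) (wedge_is_linear s).

Lemma wedge0l t : wedge 0 t = 0.
Proof. by have := wedgeZl 0 0 t; rewrite !scale0r. Qed.

Lemma wedge_suml (I : finType) (P : pred I) (f : I -> ext L m) t :
  wedge (\sum_(i | P i) f i) t = \sum_(i | P i) wedge (f i) t.
Proof.
apply: (big_morph (fun s => wedge s t)) => [s s'|]; first exact: wedgeDl.
exact: wedge0l.
Qed.

Lemma wedge1l t : wedge 1e t = t.
Proof.
apply/ffunP=> A; rewrite ffunE (bigD1 set0) ?sub0set //= big1 ?addr0.
  by rewrite ffunE eqxx inversions0l setD0 expr0 !mul1r.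
by move=> B /andP[_ B0]; rewrite ffunE (negPf B0) mulr0 mul0r.
Qed.

Lemma wedge_ext1E w s A :
  wedge (ext1 w) s A = \sum_(i in A) esgn L i (A :\ i) * w i 0 * s (A :\ i).
Proof.
rewrite /ext1 wedge_suml sum_ffunE [RHS]big_mkcond; apply: eq_bigr => i _ /=.
rewrite wedgeZl !ffunE /GRing.scale /=; case: ifP => iA.
  rewrite (bigD1 [set i]) ?sub1set //= big1 ?addr0; last first.
    by move=> B /andP[_ Bi]; rewrite ffunE (negPf Bi) mulr0 mul0r.
  by rewrite ffunE eqxx mulr1 mulrA [w i 0 * _]mulrC.
rewrite big1 ?mulr0 // => B BA; rewrite ffunE; case: eqP => [Bi|_].
  by rewrite Bi sub1set iA in BA.

by rewrite mulr0 mul0r.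
Qed.

Lemma contractE th s A :
  contract th s A = \sum_(i | i \notin A) esgn L i A * th i 0 * s (i |: A).
Proof. by rewrite ffunE. Qed.

Fact contract_is_linear th : linear (contract th).
Proof.
move=> a s t; apply/ffunP=> A; rewrite !ffunE scaler_sumr -big_split /=.
apply: eq_bigr => i _; rewrite !ffunE mulrDr; congr (_ + _).
by rewrite /GRing.scale /= mulrCA.
Qed.
HB.instance Definition _ th :=
  GRing.isLinear.Build L (ext L m) (ext L m) *:%R (contract th)
    (contract_is_linear th).

Fact ext1_is_linear : linear (@ext1 L m).
Proof.
move=> a v w; rewrite /ext1 scaler_sumr -big_split; apply: eq_bigr => i _ /=.
by rewrite !mxE scalerDl scalerA.
Qed.
HB.instance Definition _ :=
  GRing.isLinear.Build L 'cV[L]_m (ext L m) *:%R (@ext1 L m) ext1_is_linear.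

Lemma ext1E w i : ext1 w [set i] = w i 0.
Proof.
rewrite /ext1 sum_ffunE (bigD1 i) //= big1 ?addr0 => [|j ji].
  by rewrite !ffunE eqxx /GRing.scale /= mulr1.
rewrite !ffunE; case: eqP => [/set1_inj ij|_]; last exact: scaler0.
by rewrite ij eqxx in ji.
Qed.

Lemma ext1_inj : injective (@ext1 L m).
Proof. by move=> v w vw; apply/colP=> i; rewrite -!ext1E vw. Qed.

Lemma contractZl a th s : contract (a *: th) s = a *: contract th s.
Proof.
apply/ffunP=> A; rewrite !ffunE scaler_sumr; apply: eq_bigr => i _ /=.
by rewrite mxE /GRing.scale /= mulrCA !mulrA.
Qed.

Lemma contract0l s : contract 0 s = 0.
Proof. by have := contractZl 0 0 s; rewrite !scale0r. Qed.

(** Exchanging the two removed indices flips the sign, by [esgn_swap]. *)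
Lemma wedge_ext1_anticomm v w s :
  wedge (ext1 v) (wedge (ext1 w) s) = - wedge (ext1 w) (wedge (ext1 v) s).
Proof.
apply/ffunP=> A; rewrite [RHS]ffunE !wedge_ext1E.
have E u u' : \sum_(i in A) esgn L i (A :\ i) * u i 0 * wedge (ext1 u') s (A :\ i)
  = \sum_(p | [&& p.1 \in A, p.2 \in A & p.1 != p.2])
      esgn L p.1 (A :\ p.1) * esgn L p.2 (A :\ p.1 :\ p.2)
        * u p.1 0 * u' p.2 0 * s (A :\ p.1 :\ p.2).
  rewrite (eq_bigr (fun i => \sum_(j in A :\ i) esgn L i (A :\ i)
     * esgn L j (A :\ i :\ j) * u i 0 * u' j 0 * s (A :\ i :\ j))); last first.
    move=> i _; rewrite wedge_ext1E mulr_sumr; apply: eq_bigr => j _.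
    by rewrite -!mulrA; congr (_ * _); rewrite mulrCA.
  rewrite pair_big_dep; apply: eq_bigl => -[i j] /=.
  by rewrite in_setD1 [_ && (j \in A)]andbC eq_sym.
rewrite !E -sumrN (reindex_inj (h := fun p : 'I_m * 'I_m => (p.2, p.1))) /=;
  last by move=> [a b] [c d] [-> ->].
apply: eq_big => [[i j]|[i j]] /=; first by rewrite andbCA eq_sym.
case/and3P => iA jA ij.
set C := A :\ i :\ j.
have Dij : A :\ j :\ i = C by rewrite /C !setDDl setUC.
have iC : i \notin C by rewrite !inE eqxx andbF.
have jC : j \notin C by rewrite !inE eqxx.
have -> : A :\ i = j |: C by rewrite setD1K // !inE ij.
have -> : A :\ j = i |: C by rewrite -Dij setD1K // !inE eq_sym ij.
rewrite setU1K //.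
by rewrite (esgn_swap L ij jC iC); ring.
Qed.

Lemma wedge_ext1_sqr v s : wedge (ext1 v) (wedge (ext1 v) s) = 0.
Proof.
have /eqP := wedge_ext1_anticomm v v s; rewrite -addr_eq0 => /eqP E.
apply/ffunP=> A; move/ffunP/(_ A): E; rewrite !ffunE => /eqP.
by rewrite -mulr2n mulrn_eq0 /= => /eqP.
Qed.

(** The Clifford relation: the diagonal terms give the scalar, and the others
    cancel by [esgn_swapC]. *)
Lemma contract_wedge_ext1 th w s :
  contract th (wedge (ext1 w) s)
  = (th^T *m w) 0 0 *: s - wedge (ext1 w) (contract th s).
Proof.
apply/ffunP=> A; rewrite contractE [RHS]ffunE [X in _ = _ + X]ffunE.
rewrite wedge_ext1E ffunE mxE /GRing.scale /= mulr_suml.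
rewrite [X in _ = X - _](bigID (mem A)) /=.
have H : \sum_(i in A) th^T 0 i * w i 0 * s A
    - \sum_(i in A) esgn L i (A :\ i) * w i 0 * contract th s (A :\ i)
  = - \sum_(j in A) \sum_(i | i \notin A)
      esgn L j (A :\ j) * esgn L i (A :\ j) * th i 0 * w j 0 * s (i |: A :\ j).
  rewrite -sumrB -sumrN; apply: eq_bigr => j jA; rewrite contractE.
  rewrite (bigD1 j) ?setD11 //= setD1K // mxE mulrDr opprD addrA.
  have -> : th j 0 * w j 0 * s A - esgn L j (A :\ j) * w j 0
    * (esgn L j (A :\ j) * th j 0 * s A) = 0.
    by rewrite -[X in X - _]mul1r -(esgn_sqr L j (A :\ j)); ring.
  rewrite add0r mulr_sumr; congr (- _); apply: eq_big => [i|i _]; last by ring.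
  by rewrite !inE; case: eqP => [->|_] //=; rewrite ?jA // andbT.
rewrite addrAC [X in _ = X + _]H addrC exchange_big -sumrN -big_split /=.
apply: eq_bigr => i iA.
rewrite wedge_ext1E big_setU1 //= setU1K // mxE mulrDr.
rewrite [X in X + _](_ : _ = th i 0 * w i 0 * s A); last first.
  by rewrite -[RHS]mul1r -(esgn_sqr L i A); ring.
congr (_ + _); rewrite mulr_sumr -sumrN; apply: eq_bigr => j jA.
have ij : i != j by apply: contraNneq iA => ->.
have -> : (i |: A) :\ j = i |: A :\ j.
  by apply/setP=> k; rewrite !inE; case: (k =P i) => [->|//]; rewrite ij.
rewrite -{1}[A](setD1K jA).
set C := A :\ j.
have iC : i \notin C by rewrite !inE negb_and iA orbT.
have jC : j \notin C by rewrite setD11.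
have := esgn_swapC L ij iC jC => E.
transitivity ((esgn L i (j |: C) * esgn L j (i |: C))
  * (th i 0 * w j 0 * s (i |: C))); first by ring.
by rewrite E; ring.
Qed.

(** Associativity for a first factor of degree one; with [ext_ind] this is all
    that is needed of the associativity of the wedge product. *)
Lemma wedge_ext1A w s t :
  wedge (wedge (ext1 w) s) t = wedge (ext1 w) (wedge s t).
Proof.
apply/ffunP=> A; rewrite wedge_ext1E ffunE.
under eq_bigr => B _ do rewrite wedge_ext1E mulr_sumr mulr_suml.
rewrite (exchange_big_dep (mem A)) /=; last first.
  by move=> B i /subsetP BA /BA.
apply: eq_bigr => i iA; rewrite ffunE mulr_sumr.
rewrite (reindex_onto (fun C => i |: C) (fun B => B :\ i)) /=; last first.
  by move=> B /andP[_ iB]; rewrite setD1K.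
apply: eq_big => [C|C].
  rewrite subUset sub1set iA setU11 andbT /= subsetD1.
  case: (boolP (i \in C)) => iC; last by rewrite setU1K ?eqxx ?andbT.
  rewrite andbF; apply/negP=> /andP[_ /eqP Ci].
  by move: iC; rewrite -Ci !inE eqxx.
case/andP=> /andP[CA _] /eqP Ci.
have iC : i \notin C by rewrite -Ci !inE eqxx.
have CAi : C \subset A :\ i.
  by rewrite subsetD1 iC andbT; apply: subset_trans CA; apply: subsetUr.
rewrite Ci -setDDl inversionsUl ?disjoint1D // exprD -/(esgn L _ _).
set D := A :\ i :\: C.
have dCD : [disjoint C & D] by rewrite -setI_eq0 setIDA setDIl setDv set0I.
have -> : esgn L i (A :\ i) = esgn L i C * esgn L i D.
  by rewrite -esgnU // -(setID (A :\ i) C) (setIidPr CAi).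
by ring.
Qed.

Lemma wedge_delta_basis i A : i \notin A ->
  wedge (ext1 (delta_mx i 0)) (ext_basis L A) = esgn L i A *: ext_basis L (i |: A).
Proof.
move=> iA; apply/ffunP=> B; rewrite wedge_ext1E !ffunE /GRing.scale /=.
have [->|BiA] := eqVneq B (i |: A).
  rewrite (bigD1 i) ?setU11 //= setU1K // big1 => [|j /andP[_ ji]].
    by rewrite mxE ffunE !eqxx /= addr0 !mulr1.
  by rewrite mxE (negPf ji) mulr0 mul0r.
rewrite mulr0 big1 // => j jB; rewrite mxE ffunE eqxx andbT.
case: (j =P i) => [ji|_]; last by rewrite mulr0 mul0r.
case: eqP => [BA|_]; last by rewrite mulr0.
by rewrite -BA -ji setD1K ?eqxx in BiA.
Qed.

Lemma ext_sum_basis s : s = \sum_A s A *: ext_basis L A.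
Proof.
apply/ffunP=> B; rewrite sum_ffunE (bigD1 B) //= big1 => [|A AB].
  by rewrite !ffunE eqxx /GRing.scale /= mulr1 addr0.
by rewrite !ffunE eq_sym (negPf AB) scaler0.
Qed.

(** H^* is generated from 1 by multiplications by vectors: e_A is plus or minus
    e_i /\ e_(A :\ i). Proofs along this principle avoid subsets and signs. *)
Lemma ext_ind (P : ext L m -> Prop) :
    (forall a s t, P s -> P t -> P (a *: s + t)) -> P 1e ->
    (forall w s, P s -> P (wedge (ext1 w) s)) ->
  forall s, P s.
Proof.
move=> Plin P1 Pw s.
have P0 : P 0 by rewrite -(subrr 1e) addrC -scaleN1r; apply: Plin.
have Pb A : P (ext_basis L A).
  have [k] := ubnP #|A|; elim: k A => // k IHk A.
  have [->//|[i iA]] := set_0Vmem A.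
  rewrite (cardsD1 i) iA ltnS => /IHk/(Pw (delta_mx i 0)).
  rewrite wedge_delta_basis ?setD11 // setD1K // => PA.
  rewrite -[ext_basis _ _]scale1r -(esgn_sqr L i (A :\ i)) -scalerA -[_ *: _]addr0.
  exact: Plin.
rewrite [s]ext_sum_basis; elim/big_rec: _ => // A t _; exact: Plin.
Qed.

End Exterior.

Section Functoriality.
Variables (L : numFieldType) (m : nat).
Implicit Types (s t : ext L m) (A B : 'M[L]_m) (S : {set 'I_m}) (i j : 'I_m).
Implicit Types (v w th : 'cV[L]_m).

Local Notation "1e" := (ext_basis L set0) (at level 0).

(** For l = enum 'I_m this is the image of e_S under the algebra morphism
    induced by A; other lists occur in inductions. *)
Definition wedge_seq (A : 'M[L]_m) (S : {set 'I_m}) (l : seq 'I_m) : ext L m :=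
  foldr (fun i t => if i \in S then wedge (ext1 (col i A)) t else t) 1e l.

Lemma eq_wedge_seq A S S' l : {in l, S =i S'} ->
  wedge_seq A S l = wedge_seq A S' l.
Proof.
elim: l => //= i l IHl SS'; rewrite SS' ?mem_head // IHl // => j jl.
by rewrite SS' // inE jl orbT.
Qed.

Lemma wedge_seq_mem A S l i : i \in l -> i \in S ->
  wedge (ext1 (col i A)) (wedge_seq A S l) = 0.
Proof.
elim: l => //= j l IHl; rewrite inE => /predU1P[->|il] iS.
  by rewrite iS wedge_ext1_sqr.
case: ifP => _; last exact: IHl.
by rewrite wedge_ext1_anticomm IHl // linear0 oppr0.
Qed.

(** A e_i moves to its place past the factors that precede it, changing sign at
    each of them. *)
Lemma wedge_seq_cons A S l i : pairwise (relpre val ltn) l ->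
    i \in l -> i \notin S ->
  wedge (ext1 (col i A)) (wedge_seq A S l)
  = (-1) ^+ (\sum_(j <- l | j \in S) (j < i)%N) *: wedge_seq A (i |: S) l.
Proof.
elim: l => //= j l IHl /andP[/allP jl sl]; rewrite inE => /predU1P[->|il] iS.
  rewrite (negPf iS) setU11 big_cons (negPf iS) big_seq_cond big1 => [|k].
    rewrite scale1r; congr wedge; apply: eq_wedge_seq => k /jl ik.
    by rewrite !inE; case: (k =P j) ik => // ->; rewrite /= ltnn.
  by case/andP=> /jl /= /ltnW; rewrite leqNgt => /negPf->.
have ji : (j < i)%N by exact: jl.
have nji : (j == i) = false by apply: contraTF ji => /eqP->; rewrite ltnn.
rewrite big_cons !inE nji /=; case: ifP => jS; last exact: IHl.
rewrite ji exprD wedge_ext1_anticomm IHl // linearZ /= expr1 mulN1r scaleNr.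
by [].
Qed.

(** The algebra endomorphism of the exterior algebra induced by A. *)
Definition ext_map (A : 'M[L]_m) s : ext L m :=
  \sum_(S : {set 'I_m}) s S *: wedge_seq A S (enum 'I_m).

Fact ext_map_is_linear A : linear (ext_map A).
Proof.
move=> a s t; rewrite /ext_map scaler_sumr -big_split; apply: eq_bigr => S _ /=.
by rewrite !ffunE scalerDl scalerA.
Qed.
HB.instance Definition _ A :=
  GRing.isLinear.Build L (ext L m) (ext L m) *:%R (ext_map A)
    (ext_map_is_linear A).

Lemma ext_map1 A : ext_map A 1e = 1e.
Proof.
rewrite /ext_map (bigD1 set0) //= big1 => [|S S0]; last first.
  by rewrite ffunE (negPf S0) scale0r.
rewrite ffunE eqxx scale1r addr0; elim: (enum _) => //= i l ->.
by rewrite inE.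
Qed.

Lemma ext_map_wedge1 A w s :
  ext_map A (wedge (ext1 w) s) = wedge (ext1 (A *m w)) (ext_map A s).
Proof.
have -> : A *m w = \sum_i w i 0 *: col i A.
  apply/colP=> i; rewrite !mxE summxE; apply: eq_bigr => j _.
  by rewrite !mxE mulrC.
rewrite [ext1 (\sum_i _)]linear_sum [RHS]wedge_suml /ext_map.
under eq_bigr => S _ do rewrite wedge_ext1E scaler_suml.
rewrite (exchange_big_dep predT) //=; apply: eq_bigr => i _.
rewrite linearZ wedgeZl linear_sum scaler_sumr /=.
rewrite [RHS](bigID (fun S : {set 'I_m} => i \in S)) /= [X in _ = X + _]big1 => [|S iS]; last first.
  by rewrite wedgeZr wedge_seq_mem ?mem_enum // !scaler0.
rewrite add0r [LHS](reindex_onto (fun C => i |: C) (fun D => D :\ i)) /=; last first.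
  by move=> B iB; rewrite setD1K.
apply: eq_big => [C|C].
  rewrite setU11 /=; case: (boolP (i \in C)) => iC; last by rewrite setU1K ?eqxx.
  by apply/negP=> /eqP Ci; move: iC; rewrite -Ci !inE eqxx.
case/andP=> _ /eqP Ci.
have iC : i \notin C by rewrite -Ci !inE eqxx.
rewrite Ci wedgeZr wedge_seq_cons ?mem_enum //; last first.
  rewrite -sorted_pairwise; last by move=> x y z /=; apply: ltn_trans.
  by rewrite -sorted_map val_enum_ord iota_ltn_sorted.
rewrite !scalerA big_enum_cond /= /esgn inversions_sum big_set1.
by congr (_ *: _); ring.
Qed.

(** The recursion along [ext_ind] determines [ext_map A]; its functoriality and
    its value at - 1 follow. *)
Lemma ext_map_unique A (f : ext L m -> ext L m) :
    linear f -> f 1e = 1e ->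
    (forall w s, f (wedge (ext1 w) s) = wedge (ext1 (A *m w)) (f s)) ->
  f =1 ext_map A.
Proof.
move=> flin f1 fw; apply: ext_ind => [a s t fs ft||w s fs].
- by rewrite flin linearP fs ft.
- by rewrite ext_map1.
- by rewrite fw ext_map_wedge1 fs.
Qed.

Lemma ext_mapM A B s : ext_map (A *m B) s = ext_map A (ext_map B s).
Proof.
symmetry; apply: (@ext_map_unique _ (ext_map A \o ext_map B)) => /=.
- exact: linearP.
- by rewrite !ext_map1.
- by move=> w t; rewrite !ext_map_wedge1 mulmxA.
Qed.

Lemma ext_map_opp1 s S : ext_map (- 1%:M) s S = (-1) ^+ #|S| * s S.
Proof.
pose f s : ext L m := [ffun S : {set 'I_m} => (-1) ^+ #|S| * s S].
suff -> : ext_map (- 1%:M) s = f s by rewrite ffunE.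
symmetry; apply: ext_map_unique => [a t t'||w t].
- by apply/ffunP=> T; rewrite !ffunE /GRing.scale /=; ring.
- apply/ffunP=> T; rewrite !ffunE; case: eqP => [->|_]; last by rewrite mulr0.
  by rewrite cards0 mulr1.
- apply/ffunP=> T; rewrite ffunE !wedge_ext1E mulr_sumr; apply: eq_bigr => i iT.
  rewrite ffunE (cardsD1 i) iT exprS mulNmx mul1mx mxE; ring.
Qed.

Lemma ext_map_wedge A s t : ext_map A (wedge s t) = wedge (ext_map A s) (ext_map A t).
Proof.
elim/ext_ind: s => [a s s' IH IH'||w s IH].
- by rewrite wedgeDl wedgeZl !linearP /= wedgeDl wedgeZl IH IH'.
- by rewrite ext_map1 !wedge1l.
- by rewrite wedge_ext1A !ext_map_wedge1 wedge_ext1A IH.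
Qed.

Lemma contract1 th : contract th 1e = 0.
Proof.
apply/ffunP=> S; rewrite contractE big1 ?ffunE // => i iS; rewrite ffunE.
by case: eqP => [/setP/(_ i)|_]; [rewrite !inE eqxx | rewrite mulr0].
Qed.

(** Both sides obey the recursion given by the Clifford relation, the
    contragredient A' of A being what preserves the duality pairing. *)
Lemma ext_map_contract A A' th s : A'^T *m A = 1%:M ->
  ext_map A (contract th s) = contract (A' *m th) (ext_map A s).
Proof.
move=> A'A; elim/ext_ind: s => [a s s' IH IH'||w s IH].
- by rewrite !linearP /= IH IH'.
- by rewrite contract1 linear0 ext_map1 contract1.
- rewrite contract_wedge_ext1 !linearB /= !ext_map_wedge1 linearZ /=.
  rewrite contract_wedge_ext1 IH; congr (_ *: _ - _).
  by rewrite trmx_mul -mulmxA (mulmxA A'^T) A'A mul1mx.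
Qed.

Lemma ext_map_exp A s : ext_map A s = s -> ext_map A (ext_exp s) = ext_exp s.
Proof.
move=> As; rewrite linear_sum; apply: eq_bigr => k _ /=; rewrite linearZ /=.
congr (_ *: _); elim: (nat_of_ord k) => [|j IHj] /=; first exact: ext_map1.
by rewrite ext_map_wedge As IHj.
Qed.
End Functoriality.

Section Naturality.
Variables (L L' : numFieldType) (f : {rmorphism L -> L'}) (m : nat).

Lemma map_ext_wedge (s t : ext L m) :
  map_ext f (wedge s t) = wedge (map_ext f s) (map_ext f t).
Proof.
apply/ffunP=> A; rewrite !ffunE rmorph_sum; apply: eq_bigr => B _ /=.
by rewrite !rmorphM rmorphXn rmorphN1 !ffunE.
Qed.

Lemma map_ext_basis (A : {set 'I_m}) : map_ext f (ext_basis L A) = ext_basis L' A.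
Proof. by apply/ffunP=> B; rewrite !ffunE rmorph_nat. Qed.

Lemma map_extD (s t : ext L m) : map_ext f (s + t) = map_ext f s + map_ext f t.
Proof. by apply/ffunP=> A; rewrite !ffunE rmorphD. Qed.

Lemma map_extZ a (s : ext L m) : map_ext f (a *: s) = f a *: map_ext f s.
Proof. by apply/ffunP=> A; rewrite !ffunE /GRing.scale /= rmorphM. Qed.

Lemma map_ext1 w : map_ext f (@ext1 L m w) = ext1 (map_mx f w).
Proof.
rewrite /ext1.
have E : {morph (@map_ext L L' f m) : x y / x + y} := map_extD.
rewrite (big_morph _ E (id1 := 0)); last first.
  by apply/ffunP=> A; rewrite !ffunE rmorph0.
by apply: eq_bigr => i _; rewrite map_extZ map_ext_basis mxE.
Qed.

Lemma map_ext_map (A : 'M_m) (s : ext L m) :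
  map_ext f (ext_map A s) = ext_map (map_mx f A) (map_ext f s).
Proof.
elim/ext_ind: s => [a s t IHs IHt||w s IHs].
- by rewrite linearP !map_extD !map_extZ linearP IHs IHt.
- by rewrite ext_map1 !map_ext_basis ext_map1.
- by rewrite ext_map_wedge1 !map_ext_wedge !map_ext1 ext_map_wedge1 IHs map_mxM.
Qed.

Lemma map_ext_inj : injective (@map_ext L L' f m).
Proof.
move=> s t /ffunP st; apply/ffunP=> A; move: (st A); rewrite !ffunE.
exact: fmorph_inj.
Qed.
End Naturality.

(** * The spin representation and its main antiautomorphism *)

Section Adjoint.
Variables (L : numFieldType) (m : nat).
Implicit Types (s t : ext L m) (S T : {set 'I_m}) (i j : 'I_m).
Implicit Types (f g : 'End(ext L m)).

Local Notation "1e" := (ext_basis L set0) (at level 0).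
Definition clifford_act (v : 'cV[L]_(m + m)) s : ext L m :=
  wedge (ext1 (usubmx v)) s + contract (dsubmx v) s.

Fact clifford_act_is_linear v : linear (clifford_act v).
Proof. by move=> a s t; rewrite /clifford_act !linearP /= scalerDr addrACA. Qed.
HB.instance Definition _ v :=
  GRing.isLinear.Build L (ext L m) (ext L m) *:%R (clifford_act v)
    (clifford_act_is_linear v).

Lemma spin_actE (v : 'cV[L]_(m + m)) s :
  spin_act v s = wedge (ext1 (usubmx v)) s + contract (dsubmx v) s.
Proof. exact: (lfunE (clifford_act v) s). Qed.

(** The sign of the coefficient of e_S, e_(~: S) in the pairing of s and t
    defined as the top coefficient of (reversal of s) /\ t: reversal contributes
    k (k - 1) / 2 transpositions for k = #|S|, and the inversions of S against
    its complement are the sum of S minus k (k - 1) / 2. *)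
Definition psgn S : L := (-1) ^+ (\sum_(i in S) i).

Lemma psgn_sqr S : psgn S * psgn S = 1.
Proof. by rewrite /psgn -exprD addnn -signr_odd odd_double. Qed.

Lemma sgn_sqr k : (-1) ^+ k * (-1) ^+ k = 1 :> L.
Proof. by rewrite -exprMn mulN1r opprK expr1n. Qed.

Lemma psgnU1 i S : i \notin S -> psgn (i |: S) = (-1) ^+ i * psgn S.
Proof. by move=> iS; rewrite /psgn big_setU1 //= exprD. Qed.

(** The indices smaller than i are shared between S and the complement of i |:
    S. *)
Lemma esgn_compl i S : i \notin S ->
  esgn L i (~: (i |: S)) = (-1) ^+ i * esgn L i S.
Proof.
move=> iS; suff H : esgn L i S * esgn L i (~: (i |: S)) = (-1) ^+ i.
  by rewrite -H mulrAC esgn_sqr mul1r.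
rewrite -esgnU; last first.
  by rewrite disjoints_subset setCK subsetUr.
have -> : S :|: ~: (i |: S) = [set~ i].
  apply/setP=> k; rewrite !inE negb_or; case: (boolP (k \in S)) => kS.
    by symmetry; apply: contraNneq iS => <-.
  by rewrite andbT.
rewrite /esgn inversions_sum big_set1 big_mkcond /=; congr (_ ^+ _).
rewrite (eq_bigr (fun j : 'I_m => if (j < i)%N then 1%N else 0%N)) => [|j _].
  by rewrite -big_mkcond /= -(big_ord_widen _ (fun=> 1%N) (ltnW (ltn_ord i)))
    sum1_card card_ord.
by rewrite !inE; case: eqP => [->|_] /=; [rewrite ltnn | case: ltnP].
Qed.

Definition coeff f S T : L := f (ext_basis L T) S.

Lemma coeffE f s S : f s S = \sum_T coeff f S T * s T.
Proof.
rewrite {1}[s]ext_sum_basis linear_sum sum_ffunE; apply: eq_bigr => T _ /=.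
by rewrite linearZ ffunE /coeff /GRing.scale /= mulrC.
Qed.

Lemma coeff_inj f g : (forall S T, coeff f S T = coeff g S T) -> f = g.
Proof.
move=> fg; apply/lfunP=> s; apply/ffunP=> S; rewrite !coeffE.
by apply: eq_bigr => T _; rewrite fg.
Qed.

Lemma coeff_comp f g S T :
  coeff (f \o g)%VF S T = \sum_U coeff f S U * coeff g U T.
Proof. by rewrite {1}/coeff comp_lfunE coeffE. Qed.

Lemma coeff_add a f g S T :
  coeff (a *: f + g) S T = a * coeff f S T + coeff g S T.
Proof. by rewrite /coeff add_lfunE scale_lfunE !ffunE. Qed.

Lemma coeff_spin_act v S T :
  coeff (spin_act v) S T
  = \sum_(i | (i \notin T) && (S == i |: T)) esgn L i T * usubmx v i 0
    + \sum_(i | (i \in T) && (S == T :\ i)) esgn L i S * dsubmx v i 0.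
Proof.
rewrite /coeff spin_actE ffunE wedge_ext1E contractE; congr (_ + _).
  rewrite big_mkcond [RHS]big_mkcond; apply: eq_bigr => i _; rewrite ffunE.
  have [iS|iS] := boolP (i \in S); last first.
    by case: eqP iS => [->|]; rewrite ?andbF // setU11.
  case: eqP => [<-|ST]; first by rewrite setD11 setD1K ?eqxx //= mulr1.
  rewrite mulr0; case: ifP => // /andP[iT /eqP SiT].
  by case: ST; rewrite SiT setU1K.
rewrite big_mkcond [RHS]big_mkcond; apply: eq_bigr => i _; rewrite ffunE.
have [iS|iS] /= := boolP (i \in S).
  by case: eqP iS => [->|]; rewrite ?andbF // setD11.
case: eqP => [<-|ST]; first by rewrite setU11 setU1K ?eqxx //= mulr1.
rewrite mulr0; case: ifP => // /andP[iT /eqP SiT].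
by case: ST; rewrite SiT setD1K.
Qed.

(** The transpose for the pairing e_S, e_(~: S) |-> psgn S. Vectors of V are
    self-adjoint for this pairing, which makes it the main antiautomorphism. *)
Definition adjoint_fun f s : ext L m :=
  [ffun S : {set 'I_m} => \sum_T psgn S * psgn T * coeff f (~: T) (~: S) * s T].

Fact adjoint_fun_is_linear f : linear (adjoint_fun f).
Proof.
move=> a s t; apply/ffunP=> S; rewrite !ffunE scaler_sumr -big_split /=.
by apply: eq_bigr => T _; rewrite !ffunE /GRing.scale /=; ring.
Qed.
HB.instance Definition _ f :=
  GRing.isLinear.Build L (ext L m) (ext L m) *:%R (adjoint_fun f)
    (adjoint_fun_is_linear f).

Definition adjoint f : 'End(ext L m) := linfun (adjoint_fun f).

Lemma coeff_adjoint f S T :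
  coeff (adjoint f) S T = psgn S * psgn T * coeff f (~: T) (~: S).
Proof.
rewrite {1}/coeff lfunE ffunE (bigD1 T) //= big1 => [|U UT].
  by rewrite ffunE eqxx mulr1 addr0.
by rewrite ffunE (negPf UT) mulr0.
Qed.

Lemma adjoint_comp f g : adjoint (f \o g)%VF = (adjoint g \o adjoint f)%VF.
Proof.
apply: coeff_inj => S T; rewrite coeff_comp coeff_adjoint coeff_comp mulr_sumr.
rewrite (reindex_inj (can_inj (@setCK _))) /=; apply: eq_bigr => U _.
rewrite !coeff_adjoint -[LHS]mulr1 -(psgn_sqr U); ring.
Qed.

Lemma adjoint_spin_act v : adjoint (spin_act v) = spin_act v.
Proof.
apply: coeff_inj => S T; rewrite coeff_adjoint !coeff_spin_act mulrDr !mulr_sumr.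
congr (_ + _).
  apply: eq_big => i.
    rewrite !inE negbK; case: (boolP (i \in S)) => iS /=; last first.
      by symmetry; apply/negP=> /andP[_ /eqP E]; rewrite E setU11 in iS.
    apply/eqP/andP=> [TS|[iT /eqP->]].
      have -> : T = S :\ i.
        by rewrite -[T]setCK TS setCU setCK setDE setIC.
      by rewrite setD11 setD1K.
    by rewrite setCU setUC -[RHS]setUC; apply/setP=> k; rewrite !inE;
      case: (k =P i) => [->|]; rewrite ?iT.
  rewrite !inE negbK => /andP[iS /eqP TS].
  have iT : i \notin T by rewrite -in_setC TS setU11.
  have ST : S = i |: T.
    by rewrite -[T]setCK TS setCU setCK setIC -setDE setD1K.
  rewrite ST psgnU1 // esgn_compl //.
  transitivity (((-1) ^+ i * (-1) ^+ i) * (psgn T * psgn T)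
    * (esgn L i T * usubmx v i 0)); first by ring.
  by rewrite psgn_sqr sgn_sqr !mul1r.
apply: eq_big => i.
  rewrite !inE; case: (boolP (i \in S)) => iS /=.
    by symmetry; apply/negP=> /andP[_ /eqP E]; rewrite E setD11 in iS.
  apply/eqP/andP=> [TS|[iT /eqP->]].
    have -> : T = i |: S by rewrite -[T]setCK TS setCD setCK setUC.
    by rewrite setU11 setU1K.
  by rewrite setCD; apply/setP=> k; rewrite !inE; case: (k =P i) => [->|];
    rewrite ?iT ?andbF ?orbF.
rewrite !inE => /andP[iS /eqP TS].
have ST : T = i |: S by rewrite -[T]setCK TS setCD setCK setUC.
rewrite ST psgnU1 // esgn_compl //.
transitivity (((-1) ^+ i * (-1) ^+ i) * (psgn S * psgn S)
  * (esgn L i S * dsubmx v i 0)); first by ring.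
by rewrite psgn_sqr sgn_sqr !mul1r.
Qed.

Lemma adjoint_is_antiautomorphism : main_antiautomorphism adjoint.
Proof.
split; [|exact: adjoint_comp|exact: adjoint_spin_act].
move=> a f g; apply: coeff_inj => S T.
by rewrite coeff_adjoint !coeff_add !coeff_adjoint; ring.
Qed.

(** Irreducibility of the spin representation: an f commuting with V maps 1,
    which is killed by all contractions, to a vector killed by all contractions,
    that is, to a multiple of 1; the spinor 1 generates. *)
Lemma commutant_scalar f :
    (forall v, (f \o spin_act v)%VF = (spin_act v \o f)%VF) ->
  exists c, forall s, f s = c *: s.
Proof.
move=> fv.
have fw w s : f (wedge (ext1 w) s) = wedge (ext1 w) (f s).
  have /lfunP/(_ s) := fv (col_mx w 0); rewrite !comp_lfunE !spin_actE.
  by rewrite col_mxKu col_mxKd !contract0l !addr0.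
have fth th s : f (contract th s) = contract th (f s).
  have /lfunP/(_ s) := fv (col_mx 0 th); rewrite !comp_lfunE !spin_actE.
  by rewrite col_mxKu col_mxKd !linear0 !wedge0l !add0r.
exists (f 1e set0).
have f1 : f 1e = f 1e set0 *: 1e.
  apply/ffunP=> S; rewrite !ffunE; case: eqP => [->|/eqP S0].
    by rewrite /GRing.scale /= mulr1.
  rewrite scaler0; have [i iS] := set0Pn _ S0.
  have := fth (delta_mx i 0) 1e; rewrite contract1 linear0.
  move/ffunP/(_ (S :\ i)); rewrite ffunE contractE (bigD1 i) ?setD11 //=.
  rewrite big1 => [|j /andP[_ ji]]; last by rewrite mxE (negPf ji) mulr0 mul0r.
  rewrite mxE !eqxx mulr1 addr0 setD1K // => /(congr1 ( *%R (esgn L i (S :\ i)))).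
  by rewrite mulr0 mulrA esgn_sqr mul1r => ->.
apply: ext_ind => [a s t fs ft|//|w s fs].
  by rewrite linearP /= fs ft scalerDr !scalerA mulrC.
by rewrite fw fs linearZ.
Qed.
End Adjoint.

Section LinearGroup.
Variables (L : numFieldType) (m : nat).
Implicit Types (A B : 'M[L]_m) (s t : ext L m).

Definition ext_lfun A : 'End(ext L m) := linfun (ext_map A).

Lemma ext_lfunE A s : ext_lfun A s = ext_map A s.
Proof. exact: lfunE. Qed.

Lemma ext_lfun_spin_act A A' v : A'^T *m A = 1%:M ->
  (ext_lfun A \o spin_act v)%VF
  = (spin_act (block_mx A 0 0 A' *m v) \o ext_lfun A)%VF.
Proof.
move=> A'A; apply/lfunP=> s; rewrite !comp_lfunE !ext_lfunE !spin_actE linearD /=.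
rewrite ext_map_wedge1 (ext_map_contract _ _ A'A) -{3 4}[v]vsubmxK.
by rewrite mul_block_col !mul0mx addr0 add0r col_mxKu col_mxKd.
Qed.

(** g tau(g) = c for the lift g = [ext_lfun A] of A. *)
Definition spinor_norm A c := (ext_lfun A \o adjoint (ext_lfun A))%VF = c *: \1%VF.

(** Both g and, by applying tau, tau(g) intertwine the action of V with its
    image under diag(A, A'), in opposite directions; so g tau(g) commutes with
    V. *)
Lemma spinor_norm_exists A A' : A'^T *m A = 1%:M -> exists c, spinor_norm A c.
Proof.
move=> A'A; pose P : 'M_(m + m) := block_mx A 0 0 A'.
pose P' : 'M_(m + m) := block_mx A'^T 0 0 A^T.
have PP' : P *m P' = 1%:M.
  rewrite mulmx_block !mulmx0 !mul0mx !addr0 !add0r (mulmx1C A'A).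
  by rewrite -[A']trmxK -trmx_mul (mulmx1C A'A) trmx1 -scalar_mx_block.
have H v := ext_lfun_spin_act v A'A.
have H' v : (spin_act v \o adjoint (ext_lfun A)
    = adjoint (ext_lfun A) \o spin_act (P *m v))%VF.
  by rewrite -[spin_act v]adjoint_spin_act -adjoint_comp H adjoint_comp adjoint_spin_act.
have [|c cP] := @commutant_scalar _ _ (ext_lfun A \o adjoint (ext_lfun A))%VF.
  move=> v; have -> : v = P *m (P' *m v) by rewrite mulmxA PP' mul1mx.
  by rewrite -comp_lfunA -H' !comp_lfunA H.
by exists c; apply/lfunP=> s; rewrite cP scale_lfunE id_lfunE.
Qed.

Lemma spinor_normM A B a b :
  spinor_norm A a -> spinor_norm B b -> spinor_norm (A *m B) (a * b).
Proof.
move=> Aa Bb.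
have AB : ext_lfun (A *m B) = (ext_lfun A \o ext_lfun B)%VF.
  by apply/lfunP=> s; rewrite comp_lfunE !ext_lfunE ext_mapM.
rewrite /spinor_norm AB adjoint_comp -comp_lfunA [(ext_lfun B \o _)%VF]comp_lfunA Bb.
by rewrite -comp_lfunZl -comp_lfunZr comp_lfun1l Aa scalerA mulrC.
Qed.

Lemma spinor_norm_inj A a b : spinor_norm A a -> spinor_norm A b -> a = b.
Proof.
move=> Aa Ab; have /lfunP/(_ (ext_basis L set0)) := etrans (esym Aa) Ab.
rewrite !scale_lfunE !id_lfunE => /ffunP/(_ set0).
by rewrite !ffunE eqxx /GRing.scale /= !mulr1.
Qed.

Lemma spinor_norm_opp1 : ~~ odd m -> spinor_norm (- 1%:M) 1.
Proof.
move=> m_even; rewrite /spinor_norm scale1r; apply: coeff_inj => S T.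
have cE U W : coeff (ext_lfun (- 1%:M)) U W = (-1) ^+ #|U| * (U == W)%:R.
  by rewrite /coeff ext_lfunE ext_map_opp1 ffunE.
rewrite coeff_comp (bigD1 S) //= big1 => [|U US]; last first.
  by rewrite cE eq_sym (negPf US) mulr0 mul0r.
rewrite coeff_adjoint !cE eqxx mulr1 addr0 (inj_eq (can_inj (@setCK _))).
rewrite /coeff id_lfunE ffunE eq_sym.
case: eqP => [->|_]; last by rewrite !mulr0.
rewrite psgn_sqr mul1r !mulr1 -exprD cardsC card_ord.
by rewrite -signr_odd (negPf m_even).
Qed.

(** The parity of a spinor is its eigenvalue under the lift of - 1, which is
    central. *)
Lemma ext_lfun_parity A b s : has_parity b s -> has_parity b (ext_lfun A s).
Proof.
move=> sb S Sb; rewrite ext_lfunE.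
have sE : ext_map (- 1%:M) s = (-1) ^+ b *: s.
  apply/ffunP=> T; rewrite ext_map_opp1 ffunE -signr_odd.
  by have [/eqP->//|/sb->] := boolP (odd #|T| == b); rewrite mulr0 scaler0.
have := ext_mapM (- 1%:M) A s; rewrite mulNmx mul1mx -[A in - A]mulmx1 -mulmxN.
rewrite ext_mapM sE linearZ /= => /ffunP/(_ S); rewrite ext_map_opp1 ffunE.
have -> : (-1) ^+ #|S| = - (-1) ^+ b :> L.
  by rewrite -signrN -signr_odd; congr (_ ^+ nat_of_bool _); move: Sb {sb sE}; case: (odd _); case: b.
move/eqP; rewrite /GRing.scale /= mulNr -addr_eq0 -mulr2n mulrn_eq0 /=.
by rewrite mulf_eq0 signr_eq0 => /eqP.
Qed.

Lemma is_spin_ext_map A A' : A'^T *m A = 1%:M -> spinor_norm A 1 ->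
  is_spin (ext_lfun A) (block_mx A 0 0 A').
Proof.
move=> A'A A1; split; first by move=> b s; apply: ext_lfun_parity.
exists (@adjoint L m); first exact: adjoint_is_antiautomorphism.
rewrite /spinor_norm scale1r in A1; split=> // v.
by rewrite (ext_lfun_spin_act _ A'A) -comp_lfunA A1 comp_lfun1r.
Qed.
End LinearGroup.

(** With C = (1 + A) / sqrt 2 one has C ^ 2 = A and A ^ 2 = - 1, so the norm c
    of C satisfies c ^ 4 = 1 over an ordered field; hence the norm c ^ 2 of A is
    1. *)
Lemma spinor_norm_complex_structure (R : rcfType) (m : nat) (A : 'M[R]_m) :
  ~~ odd m -> A *m A = - 1%:M -> spinor_norm A 1.
Proof.
move=> m_even AA.
pose k : R := (Num.sqrt 2)^-1.
have kk : k * k * 2 = 1.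
  by rewrite -invfM -expr2 sqr_sqrtr ?ler0n // mulVf ?pnatr_eq0.
(* D is the contragredient of C: (1 - A) (1 + A) / 2 = 1. *)
pose C : 'M[R]_m := k *: (1%:M + A); pose D : 'M[R]_m := (k *: (1%:M - A))^T.
have CC : C *m C = A.
  rewrite -scalemxAl -scalemxAr scalerA mulmxDl !mulmxDr !mul1mx !mulmx1 AA.
  by rewrite addrC addrA subrK -mulr2n -scaler_nat scalerA kk scale1r.
have DC : D^T *m C = 1%:M.
  rewrite /D trmxK -scalemxAl -scalemxAr scalerA mulmxBl !mulmxDr.
  rewrite !mul1mx !mulmx1 AA opprD opprK [- A + _]addrC addrACA subrr addr0.
  by rewrite -mulr2n -scaler_nat scalerA kk scale1r.
have [c Cc] := spinor_norm_exists DC.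
have Acc := spinor_normM Cc Cc; rewrite CC in Acc.
have := spinor_normM Acc Acc; rewrite AA => c4.
have /esym/eqP := spinor_norm_inj c4 (spinor_norm_opp1 _ m_even).
rewrite eq_sym -expr2 sqrf_eq1 => /orP[/eqP c2|/eqP c2]; first by rewrite -c2.
by have := sqr_ge0 c; rewrite expr2 c2 oppr_ge0 ler10.
Qed.

(** * Two-forms and the components of the polarization *)

Section TwoForms.
Variables (L : numFieldType) (m : nat).
Implicit Types (s t : ext L m) (A D E : 'M[L]_m) (u v w th : 'cV[L]_m).

Lemma wedge1r s : wedge s (ext_basis L set0) = s.
Proof.
apply/ffunP=> S; rewrite ffunE (bigD1 S) //= big1 ?addr0.
  by rewrite setDv ffunE eqxx mulr1 inversions_sum big1 ?mul1r // => i _;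
    rewrite big_set0.
move=> T /andP[TS TnS]; rewrite ffunE setD_eq0.
case: (boolP (S \subset T)) => ST; last by rewrite mulr0.
by rewrite eqEsubset TS ST in TnS.
Qed.

Lemma ext_map_ext1 A w : ext_map A (ext1 w) = ext1 (A *m w).
Proof. by rewrite -[ext1 w]wedge1r ext_map_wedge1 ext_map1 wedge1r. Qed.

Lemma ext1_delta (i : 'I_m) : ext1 (delta_mx i 0) = ext_basis L [set i].
Proof.
rewrite /ext1 (bigD1 i) //= big1 => [|j ji].
  by rewrite mxE !eqxx scale1r addr0.
by rewrite mxE (negPf ji) scale0r.
Qed.

(** The two-form of an arbitrary bilinear form D, depending only on D - D^T; it
    allows decomposable elements u /\ v to be handled as rank one matrices. *)
Definition two_form D : ext L m :=
  \sum_i \sum_j D i j *: wedge (ext1 (delta_mx i 0)) (ext1 (delta_mx j 0)).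

Fact two_form_is_linear : linear two_form.
Proof.
move=> a D E; rewrite /two_form scaler_sumr -big_split /=; apply: eq_bigr => i _.
rewrite scaler_sumr -big_split /=; apply: eq_bigr => j _.
by rewrite !mxE scalerDl scalerA.
Qed.
HB.instance Definition _ :=
  GRing.isLinear.Build L 'M[L]_m (ext L m) *:%R two_form two_form_is_linear.

Lemma ext1_sum_delta v : ext1 v = \sum_i v i 0 *: ext1 (delta_mx i 0).
Proof. by under eq_bigr => i _ do rewrite ext1_delta. Qed.

Lemma two_form_rank1 u v : two_form (u *m v^T) = wedge (ext1 u) (ext1 v).
Proof.
rewrite [ext1 u]ext1_sum_delta [ext1 v]ext1_sum_delta wedge_suml.
apply: eq_bigr => i _; rewrite linear_sum; apply: eq_bigr => j _ /=.
by rewrite wedgeZl wedgeZr scalerA mxE big_ord1 mxE.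
Qed.

Lemma mx_sum_rank1 D :
  D = \sum_i \sum_j D i j *: (delta_mx i 0 *m (delta_mx j 0 : 'cV_m)^T).
Proof.
rewrite {1}[D]matrix_sum_delta; apply: eq_bigr => i _; apply: eq_bigr => j _.
by rewrite trmx_delta mul_delta_mx.
Qed.

Lemma ext_map_two_form A D : ext_map A (two_form D) = two_form (A *m D *m A^T).
Proof.
rewrite [in RHS](mx_sum_rank1 D) mulmx_sumr mulmx_suml !linear_sum /=.
apply: eq_bigr => i _; rewrite mulmx_sumr mulmx_suml !linear_sum.
apply: eq_bigr => j _ /=.
rewrite -scalemxAr -scalemxAl !linearZ /= ext_map_wedge !ext_map_ext1.
by rewrite -two_form_rank1 trmx_mul !mulmxA.
Qed.

Lemma two_form_tr D : two_form D^T = - two_form D.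
Proof.
rewrite /two_form exchange_big -sumrN; apply: eq_bigr => i _ /=.
rewrite -sumrN; apply: eq_bigr => j _; rewrite mxE -scalerN; congr (_ *: _).
rewrite -[X in wedge _ X]wedge1r wedge_ext1_anticomm.
by rewrite [X in wedge _ X]wedge1r.
Qed.

Lemma two_form_sym D : D^T = D -> two_form D = 0.
Proof.
move=> Ds; have /eqP := two_form_tr D; rewrite Ds -addr_eq0 => /eqP E.
apply/ffunP=> A; move/ffunP/(_ A): E; rewrite !ffunE => /eqP.
by rewrite -mulr2n mulrn_eq0 /= => /eqP.
Qed.

Lemma contract_ext1 th w :
  contract th (ext1 w) = (th^T *m w) 0 0 *: ext_basis L set0.
Proof.
by rewrite -[ext1 w]wedge1r contract_wedge_ext1 contract1 linear0 subr0.
Qed.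

Lemma contract_two_form th D :
  contract th (two_form D) = ext1 (D^T *m th - D *m th).
Proof.
rewrite [in RHS](mx_sum_rank1 D) /two_form !linear_sum /= mulmx_suml mulmx_suml.
rewrite -sumrB linear_sum; apply: eq_bigr => i _ /=.
rewrite !linear_sum /= mulmx_suml mulmx_suml -sumrB linear_sum.
apply: eq_bigr => j _ /=; rewrite !linearZ /= -!scalemxAl -scalerBr linearZ /=.
congr (_ *: _); rewrite contract_wedge_ext1 contract_ext1 linearZ /= wedge1r.
rewrite trmx_mul trmxK -!mulmxA linearB /=.
have E k (x : 'cV[L]_m) : x *m ((delta_mx k 0 : 'cV[L]_m)^T *m th)
    = (th^T *m (delta_mx k 0 : 'cV[L]_m)) 0 0 *: x.
  rewrite [_^T *m _]mx11_scalar mul_mx_scalar; congr (_ *: _).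
  by rewrite !mxE; apply: eq_bigr => l _; rewrite !mxE mulrC.
by rewrite !E !linearZ.
Qed.

Lemma two_form_inj D E : two_form D = two_form E -> D - D^T = E - E^T.
Proof.
move=> DE; apply/matrixP=> i j.
have /(congr1 (contract (delta_mx j 0))) := DE.
rewrite !contract_two_form => /ext1_inj; rewrite -!mulmxBl => /colP/(_ i).
rewrite -!colE => /eqP; rewrite !mxE -eqr_opp !opprB => /eqP; exact.
Qed.

(** [ext2] reads only the entries above the diagonal. *)
Lemma ext2_two_form E : ext2 E = two_form (\matrix_(i, j) (E i j *+ (i < j)%N)).
Proof.
rewrite /ext2 /two_form; apply: eq_bigr => i _; rewrite big_mkcond /=.
apply: eq_bigr => j _; rewrite mxE !ext1_delta.
by case: ifP => _; rewrite ?mulr1n ?mulr0n ?scale0r.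
Qed.

Lemma skew_upper E : E^T = - E ->
  let U := \matrix_(i, j) (E i j *+ (i < j)%N) in U - U^T = E.
Proof.
move=> Esk U; apply/matrixP=> i j; rewrite !mxE.
have Eji : E j i = - E i j by have /matrixP/(_ i j) := Esk; rewrite !mxE.
rewrite Eji; case: (ltngtP i j) => ij; rewrite ?mulr1n ?mulr0n ?subr0 ?sub0r //.
  by rewrite opprK.
have /eqP : E i j = - E i j by rewrite -Eji (ord_inj ij).
by rewrite -addr_eq0 -mulr2n mulrn_eq0 /= => /eqP->.
Qed.
End TwoForms.

(** Dedekind's independence of characters, for joint eigenvectors: subtracting
    chi k a times the relation from its image under N a removes the term k. *)
Lemma independent_eigen (L : fieldType) (m p : nat) (I : eqType) (T : Type)
    (N : T -> 'M[L]_m) (chi : I -> T -> L) (X : I -> 'M[L]_(m, p)) (r : seq I) :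
    (forall i j, chi i =1 chi j -> i = j) -> uniq r ->
    (forall i a, N a *m X i = chi i a *: X i) ->
    \sum_(i <- r) X i = 0 ->
  forall i, i \in r -> X i = 0.
Proof.
move=> chi_inj; elim: r X => // k r IHr X /= /andP[kr ur] NX.
rewrite big_cons => X0.
have Xr i : i \in r -> X i = 0.
  move=> ir; apply/eqP; apply: contraT => Xi; case/negP: kr.
  suff -> : k = i by [].
  apply: chi_inj => a; apply/esym/eqP; rewrite -subr_eq0; apply: contraR Xi => nz.
  suff /eqP : (chi i a - chi k a) *: X i = 0 by rewrite scaler_eq0 (negPf nz).
  apply: (IHr (fun j => (chi j a - chi k a) *: X j)) => // [j b|].
    by rewrite -scalemxAr NX !scalerA mulrC.
  transitivity (N a *m (X k + \sum_(j <- r) X j)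
                - chi k a *: (X k + \sum_(j <- r) X j)); last first.
    by rewrite X0 mulmx0 scaler0 subr0.
  rewrite mulmxDr NX scalerDr opprD addrACA subrr add0r mulmx_sumr scaler_sumr.
  by rewrite -sumrB; apply: eq_bigr => j _; rewrite scalerBl NX.
move=> i; rewrite inE => /predU1P[->|]; last exact: Xr.
by move: X0; rewrite big_seq big1 ?addr0 // => j /Xr.
Qed.

Section ThetaComponents.
Variables (R : realType) (K : fieldExtType rat) (F : {subfield K}) (m h : nat).
Variables (etahat : subvs_of F -> 'M[rat]_m) (s : 'I_h -> {rmorphism subvs_of F -> R}).
Hypothesis s_inj : forall i j, s i =1 s j -> i = j.
Variables (Theta : 'M[rat]_m) (Thetas : 'I_h -> ext R m).
Hypothesis ThetasP : is_decomposition etahat Theta s Thetas.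
Hypothesis Theta_skew : Theta^T = - Theta.
Variable A : 'M[R]_m.
Hypothesis A_comm : forall a,
  (map_mx ratr (etahat a))^T *m A = A *m (map_mx ratr (etahat a))^T.
Hypothesis A_Theta : A *m map_mx ratr Theta *m A^T = map_mx ratr Theta.

(** In terms of the skew forms D_j - D_j^T of the components, A transforms the
    decomposition of Theta into another one into joint F-eigenvectors with the
    same characters, so [independent_eigen] identifies them term by term. *)
Lemma ext_map_component i : ext_map A (Thetas i) = Thetas i.
Proof.
have [Ths sumTh] := ThetasP.
have D_ex j : exists D : 'M[R]_m, two_form D = Thetas j /\
    forall a, (map_mx ratr (etahat a))^T *m (D - D^T) = s j a *: (D - D^T).
  have [k [u [v [uv ->]]]] := Ths j.
  exists (\sum_l u l *m (v l)^T); split.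
    by rewrite linear_sum; apply: eq_bigr => l _ /=; rewrite two_form_rank1.
  move=> a; rewrite linear_sum -sumrB mulmx_sumr scaler_sumr /=.
  apply: eq_bigr => l _; have [/(_ a) ua /(_ a) va] := uv l.
  by rewrite trmx_mul trmxK mulmxBr !mulmxA ua va -!scalemxAl scalerBr.
have [D DP] := fin_all_exists D_ex.
pose X j := A *m (D j - (D j)^T) *m A^T - (D j - (D j)^T).
have sumD : \sum_j (D j - (D j)^T) = map_mx ratr Theta.
  have Esk : (map_mx ratr Theta)^T = - map_mx ratr Theta :> 'M[R]_m.
    by rewrite map_trmx Theta_skew map_mxN.
  rewrite -(skew_upper Esk) sumrB -linear_sum /=; apply: two_form_inj.
  rewrite -ext2_two_form sumTh linear_sum; apply: eq_bigr => j _.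
  exact: (DP j).1.
have X0 j : X j = 0.
  apply: (@independent_eigen _ _ _ _ _
    (fun a => (map_mx ratr (etahat a))^T : 'M[R]_m) s X (enum 'I_h) s_inj) => //.
  - exact: enum_uniq.
  - move=> k a; have := (DP k).2 a; rewrite /X; move: (D k - _) => Y YP.
    rewrite mulmxBr YP scalerBr; congr (_ - _).
    rewrite !mulmxA A_comm -[A *m _ *m Y]mulmxA YP.
    by rewrite -scalemxAr -scalemxAl.
  - rewrite big_enum /= sumrB -mulmx_suml -mulmx_sumr sumD A_Theta subrr //.
  - by rewrite mem_enum.
rewrite -(DP i).1 ext_map_two_form; apply/eqP; rewrite -subr_eq0 -linearB /=.
apply/eqP/two_form_sym; apply/eqP; rewrite -subr_eq0; apply/eqP.
have := X0 i; rewrite /X => X0i.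
rewrite linearB /= !trmx_mul trmxK mulmxA -oppr0 -X0i mulmxBr mulmxBl.
by rewrite !opprB; apply/matrixP=> a b; rewrite !mxE; ring.
Qed.
End ThetaComponents.

(** Over the complex numbers the fixed space of ext_map A contains the pure
    spinors, hence B by its minimality. *)
Lemma ext_map_B (R : realType) (K : fieldExtType rat) (F : {subfield K})
    (m h : nat) (r : K) (s : 'I_h -> {rmorphism subvs_of F -> R})
    (Thetas : 'I_h -> ext R m) (B : {vspace ext rat m}) (A : 'M[R]_m) :
  is_B r s Thetas B -> (forall i, ext_map A (Thetas i) = Thetas i) ->
  forall b, b \in B -> ext_map A (map_ext ratr b) = map_ext ratr b.
Proof.
move=> [_ _ Bmin] AT b bB.
pose AC := map_mx (real_complex R) A.
have ratC (x : ext rat m) :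
    map_ext (real_complex R) (map_ext ratr x) = map_ext ratr x.
  by apply/ffunP=> S; rewrite !ffunE fmorph_rat.
apply: (@map_ext_inj _ _ (real_complex R)); rewrite map_ext_map ratC -/AC.
have spinor_fixed T : CM_type s T ->
    pure_spinor r Thetas T \in fixedSpace (ext_lfun AC).
  move=> _; apply/fixedSpaceP; rewrite ext_lfunE; apply: ext_map_exp.
  rewrite linear_sum; apply: eq_bigr => i _ /=.
  by rewrite linearZ /= -map_ext_map AT.
have BU x : x \in (vbasis B : seq _) ->
    ext_map AC (map_ext ratr x) = map_ext ratr x.
  move=> xB; rewrite -ext_lfunE; apply/fixedSpaceP.
  apply: (subvP (Bmin _ spinor_fixed)).
  by apply: memv_span; apply/mapP; exists x.
rewrite (coord_vbasis bB).
have E : {morph (@map_ext _ R[i] ratr m) : x y / x + y} := @map_extD _ _ _ _.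
rewrite (big_morph _ E (id1 := 0)); last first.
  by apply/ffunP=> S; rewrite !ffunE rmorph0.
rewrite linear_sum; apply: eq_bigr => i _ /=.
by rewrite map_extZ linearZ /= BU // mem_nth // size_tuple.
Qed.

(** * Positivity of self-adjoint operators *)

Lemma foldr_char_poly (R : comNzRingType) m (N : 'M[R]_m) xs x :
    char_poly N = \prod_(a <- xs) ('X - a%:P) ->
  foldr (fun a (y : 'cV[R]_m) => N *m y - a *: y) x xs = 0.
Proof.
case: m N x => [|n] N x Nxs; first by apply/matrixP=> -[].
have := Cayley_Hamilton N; rewrite Nxs => CH.
transitivity (horner_mx N (\prod_(a <- xs) ('X - a%:P)) *m x).
  elim: xs {Nxs CH} => [|a xs IHxs]; first by rewrite big_nil rmorph1 mul1mx.
  rewrite big_cons rmorphM /= rmorphB /= horner_mx_X horner_mx_C -mulmxE.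
  by rewrite -mulmxA -IHxs mulmxBl mul_scalar_mx.
by rewrite CH mul0mx.
Qed.

Section SelfAdjoint.
Variables (R : rcfType) (m : nat) (S M : 'M[R]_m).
Hypothesis S_sym : S^T = S.
Hypothesis S_pos : forall x : 'cV[R]_m, x != 0 -> 0 < (x^T *m S *m x) 0 0.
Hypothesis M_adj : M^T *m S = S *m M.
Implicit Types (x y : 'cV[R]_m).

Local Notation "''[' x , y ]" := ((x^T *m S *m y) 0 0).

Lemma dot0 x : '[x, x] = 0 -> x = 0.
Proof. by move=> x0; apply: contra_eq x0 => /S_pos/lt0r_neq0. Qed.

Lemma dot_adj x y : '[M *m x, y] = '[x, M *m y].
Proof. by rewrite trmx_mul -!mulmxA [M^T *m _]mulmxA M_adj -!mulmxA. Qed.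

Lemma dot_adj_shift a x y : '[M *m x - a *: x, y] = '[x, M *m y - a *: y].
Proof.
rewrite linearB linearZ /= !mulmxBl mulmxBr -!scalemxAl -scalemxAr.
by have := dot_adj x y; rewrite !mxE => ->.
Qed.

(** Self-adjointness for a positive form removes repeated factors: (M - a)^2 y =
    0 implies (M - a) y = 0. *)
Lemma sum_eigenvectors (xs : seq R) x :
    foldr (fun a y => M *m y - a *: y) x xs = 0 ->
  exists us (v : R -> 'cV[R]_m), [/\ uniq us, {subset us <= xs},
    forall a, M *m v a = a *: v a & x = \sum_(a <- us) v a].
Proof.
elim: xs x => [|a0 xs IHxs] x /=.
  move=> ->; exists [::], (fun=> 0); split=> // [a|]; rewrite ?big_nil //.
  by rewrite mulmx0 scaler0.
pose f a y := M *m y - a *: y; rewrite -/(f _ _) => fx0.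
have fC a b y : f a (f b y) = f b (f a y).
  rewrite /f !mulmxBr -!scalemxAr !scalerBr !scalerA mulrC !opprB.
  by apply/matrixP=> i j; rewrite !mxE; ring.
have {fx0}/IHxs [us [v [us_uniq us_xs Mv fx]]] :
    foldr (fun a y => M *m y - a *: y) (f a0 x) xs = 0.
  rewrite -[RHS]fx0; elim: (xs) => //= b l ->; exact: fC.
(* w inverts M - a0 on the part of f a0 x away from the eigenvalue a0. *)
pose w := \sum_(a <- us | a != a0) (a - a0)^-1 *: v a.
pose phi := x - w.
have fphi : f a0 phi = \sum_(a <- us | a == a0) v a.
  have -> : f a0 phi = f a0 x - f a0 w.
    rewrite /f /phi mulmxBr scalerBr.
    by apply/matrixP=> i j; rewrite !mxE; ring.
  rewrite fx (bigID (pred1 a0)) /= -addrA -[RHS]addr0; congr (_ + _).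
  apply/eqP; rewrite subr_eq0; apply/eqP.
  rewrite /f mulmx_sumr scaler_sumr -sumrB; apply: eq_bigr => a aa0.
  rewrite -scalemxAr Mv !scalerA -scalerBl mulrC -mulrBl.
  by rewrite divff ?scale1r // subr_eq0.
have {}fphi : f a0 phi = 0.
  apply: dot0; rewrite {1}/f dot_adj_shift -/(f a0 (f a0 phi)) fphi.
  rewrite [f _ _](_ : _ = 0) ?mulmx0 ?mxE //.
  rewrite /f mulmx_sumr scaler_sumr -sumrB big1 // => a /eqP->.
  by rewrite Mv subrr.
exists (a0 :: filter (predC1 a0) us), (fun a => if a == a0 then phi else (a - a0)^-1 *: v a).
split=> [|a|a|].
- by rewrite /= mem_filter /= eqxx filter_uniq.
- rewrite !inE mem_filter => /predU1P[->|/andP[_ /us_xs->]]; rewrite ?eqxx //.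
  by rewrite orbT.
- case: eqP => [->|_]; last by rewrite -scalemxAr Mv !scalerA mulrC.
  by apply/eqP; rewrite -subr_eq0; apply/eqP.
rewrite big_cons eqxx big_filter /=.
rewrite (eq_bigr (fun a => (a - a0)^-1 *: v a)) => [|a /negPf->//].
by rewrite -/w subrK.
Qed.

(** The characteristic polynomial has only positive real roots and annihilates
    M, so x is a sum of eigenvectors with distinct eigenvalues; these are
    orthogonal. *)
Lemma self_adjoint_pos :
    (forall z, eigenvalue (map_mx (real_complex R) M) z -> 0 < z) ->
  forall x, x != 0 -> 0 < '[x, M *m x].
Proof.
move=> M_pos x x0.
have [xs [xs_pos xs0]] : exists xs : seq R, (forall a, a \in xs -> 0 < a) /\
    foldr (fun a y => M *m y - a *: y) x xs = 0.
  have [zs] := closed_field_poly_normal (char_poly (map_mx (real_complex R) M)).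
  rewrite (monicP (char_poly_monic _)) scale1r => Mzs.
  have zs_pos z : z \in zs -> 0 < z.
    by move=> zzs; apply: M_pos; rewrite eigenvalue_root_char Mzs root_prod_XsubC.
  exists (map (@complex.Re R) zs); split=> [_ /mapP[z /zs_pos z_gt0 ->]|].
    by move: z_gt0; rewrite ltcE /= => /andP[].
  have Mxs : char_poly M = \prod_(a <- map (@complex.Re R) zs) ('X - a%:P).
    apply: (map_poly_inj (real_complex R)); rewrite map_char_poly Mzs rmorph_prod.
    rewrite big_map; apply: eq_big_seq => z /zs_pos; rewrite ltcE => /andP[/eqP Iz _].
    rewrite rmorphB /= map_polyX map_polyC /=; congr (_ - _%:P).
    by case: z Iz => a b /= ->.
  move: (map _ _) Mxs => xs {x0 zs Mzs zs_pos} Mxs.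
  exact: foldr_char_poly.
have [us [v [us_uniq us_xs Mv xE]]] := sum_eigenvectors xs0.
have orth a b : a != b -> '[v a, v b] = 0.
  move=> ab; have := dot_adj (v a) (v b); rewrite !Mv linearZ /= -!scalemxAl.
  rewrite -scalemxAr [LHS]mxE [RHS]mxE => /eqP.
  by rewrite -subr_eq0 -mulrBl mulf_eq0 subr_eq0 (negPf ab) => /eqP.
have -> : '[x, M *m x] = \sum_(a <- us) a * '[v a, v a].
  rewrite xE linear_sum mulmx_suml mulmx_suml summxE.
  rewrite big_seq_cond [RHS]big_seq_cond; apply: eq_bigr => a /andP[aus _].
  rewrite mulmx_sumr mulmx_sumr summxE (bigD1_seq a) //= big1 => [|b ba].
    by rewrite addr0 Mv -scalemxAr mxE.
  by rewrite Mv -scalemxAr mxE orth ?mulr0 // eq_sym.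
have term_ge0 a : a \in us -> 0 <= a * '[v a, v a].
  move=> /us_xs/xs_pos a_gt0; rewrite pmulr_rge0 //.
  have [->|/S_pos/ltW//] := eqVneq (v a) 0.
  by rewrite mulmx0 mxE.
rewrite lt_neqAle eq_sym big_seq sumr_ge0 // andbT.
apply: contra x0; rewrite -big_seq big_seq psumr_eq0 // => /allP vs0.
rewrite xE big_seq big1 // => a aus; apply/dot0/eqP.
have := vs0 _ aus; rewrite aus /= mulf_eq0 => /orP[/eqP a0|//].
by have := xs_pos _ (us_xs _ aus); rewrite a0 ltxx.
Qed.
End SelfAdjoint.

(** * Characters of a number field from joint eigenvectors *)

Section Characters.
Variables (L : fieldExtType rat) (k : nat) (f : L -> 'M[rat]_k).
Hypothesis fB : zmod_morphism f.
Hypothesis fM : forall a b, f (a * b) = f a *m f b.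
Hypothesis f1 : f 1 = 1%:M.

(** The joint eigenvalues on a common eigenvector are multiplicative and
    additive. They are read off at a nonzero coordinate of v. *)
Lemma eigen_character (C : numFieldType) (v : 'rV[C]_k) : v != 0 ->
    (forall a, stablemx v (map_mx ratr (f a))) ->
  exists sigma : {rmorphism L -> C},
    forall a, v *m map_mx ratr (f a) = sigma a *: v.
Proof.
move=> v0 v_stable; have /rV0Pn[i vi] := v0.
pose sg a := (v *m map_mx ratr (f a)) 0 i / v 0 i.
have sgE a : v *m map_mx ratr (f a) = sg a *: v.
  have /sub_rVP[c vc] := v_stable a.
  by rewrite /sg vc mxE mulfK.
have sgB : zmod_morphism sg.
  by move=> a b; rewrite /sg fB map_mxB mulmxBr !mxE mulrBl.
have sgM : monoid_morphism sg.
  split=> [|a b]; first by rewrite /sg f1 map_mx1 mulmx1 divff.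
  by rewrite {1}/sg fM map_mxM mulmxA sgE -scalemxAl sgE !mxE mulrA mulfK.
pose sB := GRing.isZmodMorphism.Build L C sg sgB.
pose sM := GRing.isMonoidMorphism.Build L C sg sgM.
pose sigma : {rmorphism L -> C} := HB.pack sg sB sM.
by exists sigma.
Qed.

(** L being finite over the rationals, finitely many commuting operators
    restricted to W have to be considered. *)
Lemma eigen_character_in (C : numClosedFieldType) (W : 'M[C]_k) : W != 0 ->
    (forall a, stablemx W (map_mx ratr (f a))) ->
  exists2 v : 'rV[C]_k, v != 0 & exists sigma : {rmorphism L -> C},
    (v <= W)%MS /\ forall a, v *m map_mx ratr (f a) = sigma a *: v.
Proof.
move=> W0 W_stable.
pose g a : 'M[C]_k := map_mx ratr (f a).
have fC a b : f a *m f b = f b *m f a by rewrite -!fM mulrC.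
have gC a b : comm_mx (g a) (g b) by rewrite /comm_mx -!map_mxM fC.
have [||v v0 /allP v_st] := @common_eigenvector C (\rank W)
    [seq restrictmx W (g b) | b <- vbasis {:L}].
- by rewrite lt0n mxrank_eq0.
- move=> _ _ /mapP[a _ ->] /mapP[b _ ->]; rewrite /comm_mx.
  by rewrite -!conjmxM ?inE ?stablemx_row_base ?W_stable // gC.
have vW : (v *m row_base W <= W)%MS by rewrite mulmx_sub // eq_row_base.
have w0 : v *m row_base W != 0 by rewrite mulmx_free_eq0 ?row_base_free.
exists (v *m row_base W) => //.
have [a|sigma sE] := @eigen_character C _ w0; last by exists sigma.
have fZ : scalable f by apply: rat_linear.
rewrite (coord_vbasis (memvf a)).
have f0 : f 0 = 0 by have := fB 0 0; rewrite !subrr.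
have E : {morph f : x y / x + y}.
  move=> x y; have := fB 0 y; rewrite f0 !sub0r => fN.
  by have := fB x (- y); rewrite fN !opprK.
rewrite (big_morph _ E f0) raddf_sum mulmx_sumr summx_sub // => i _ /=.
rewrite fZ map_mxZ -scalemxAr scalemx_sub //.
rewrite -stablemx_restrict ?W_stable //; apply: v_st; apply/mapP.
by exists (vbasis {:L})`_i; rewrite // mem_nth ?size_tuple.
Qed.
End Characters.

(** * The Rosati involution and total positivity *)

Section RealPart.
Variable R : rcfType.

Lemma map_Re_mulmx m n p (v : 'M[R[i]]_(m, n)) (N : 'M[R]_(n, p)) :
  map_mx (@complex.Re R) (v *m map_mx (real_complex R) N)
  = map_mx (@complex.Re R) v *m N.
Proof.
apply/matrixP=> i j; rewrite !mxE raddf_sum; apply: eq_bigr => k _ /=.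
by rewrite !mxE; case: (v i k) => a b /=; rewrite mulr0 subr0.
Qed.

Lemma map_Im_mulmx m n p (v : 'M[R[i]]_(m, n)) (N : 'M[R]_(n, p)) :
  map_mx (@complex.Im R) (v *m map_mx (real_complex R) N)
  = map_mx (@complex.Im R) v *m N.
Proof.
apply/matrixP=> i j; rewrite !mxE raddf_sum; apply: eq_bigr => k _ /=.
by rewrite !mxE; case: (v i k) => a b /=; rewrite mulr0 add0r.
Qed.
End RealPart.

Lemma map_ratrC (R : rcfType) m n (N : 'M[rat]_(m, n)) :
  map_mx (real_complex R) (map_mx ratr N) = map_mx ratr N.
Proof. by apply/matrixP=> i j; rewrite !mxE fmorph_rat. Qed.

(** The character of a complex eigenvector is real, so the real or the imaginary
    part of the vector is an eigenvector. *)
Lemma totally_real_eigenvector (R : realType) (L : fieldExtType rat) (k : nat)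
    (f : L -> 'M[rat]_k) :
    totally_real R L -> (0 < k)%N -> zmod_morphism f ->
    (forall a b, f (a * b) = f a *m f b) -> f 1 = 1%:M ->
  exists2 v : 'rV[R]_k, v != 0 &
    exists rho : L -> R, forall a, v *m map_mx ratr (f a) = rho a *: v.
Proof.
move=> L_real k_gt0 fB fM f1.
have [||v v0 [sg [_ vE]]] := @eigen_character_in L k f fB fM f1 R[i] 1%:M.
- by rewrite -mxrank_eq0 mxrank1 -lt0n.
- by move=> a; rewrite submx1.
have sgE a : sg a = (complex.Re (sg a))%:C%C.
  by have := L_real sg a; case: (sg a) => x y /= ->.
have [Rv0|Rv0] := eqVneq (map_mx (@complex.Re R) v) 0; last first.
  exists (map_mx (@complex.Re R) v) => //; exists (fun a => complex.Re (sg a)) => a.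
  rewrite -map_Re_mulmx map_ratrC vE sgE; apply/rowP=> j; rewrite !mxE /=.
  by case: (v 0 j) => x y /=; rewrite mul0r subr0.
exists (map_mx (@complex.Im R) v).
  apply: contra v0 => /eqP Iv0; apply/eqP/rowP=> j.
  move/rowP/(_ j): Rv0; move/rowP/(_ j): Iv0; rewrite !mxE.
  by case: (v 0 j) => x y /= -> ->.
exists (fun a => complex.Re (sg a)) => a.
rewrite -map_Im_mulmx map_ratrC vE sgE; apply/rowP=> j; rewrite !mxE /=.
by case: (v 0 j) => x y /=; rewrite mul0r addr0.
Qed.

Lemma rmorph_mulmxC (L : fieldType) (A : pzRingType) m
    (f : {rmorphism L -> 'M[A]_m}) a b :
  f a *m f b = f b *m f a.
Proof. by rewrite !mulmxE -!rmorphM mulrC. Qed.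

Section Polarization.
Variables (R : realType) (m : nat) (J : 'M[R]_m) (Theta : 'M[rat]_m).
Hypothesis JJ : J *m J = - 1%:M.
Hypothesis ThetaP : is_polarization J Theta.

Local Notation E := (map_mx ratr Theta : 'M[R]_m).

Lemma E_skew : E^T = - E.
Proof. by case: ThetaP => Tsk _ _; rewrite map_trmx Tsk map_mxN. Qed.

Lemma J_E : J^T *m E = - (E *m J).
Proof.
have [_ JEJ _] := ThetaP.
rewrite -{2}JEJ -[_ *m E *m J *m J]mulmxA JJ mulmxN mulmx1 opprK.
by [].
Qed.

Lemma Theta_unit : Theta \in unitmx.
Proof.
rewrite -(map_unitmx (@ratr R)) -row_free_unit -kermx_eq0; apply/rowV0P=> v.
move/sub_kermxP=> vE; apply/eqP; apply: contraT => v0.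
have [_ _ /(_ v^T)] := ThetaP.
by rewrite trmx_eq0 trmxK vE mul0mx mxE ltxx => ->.
Qed.

Lemma E_unit : E \in unitmx.
Proof. by rewrite map_unitmx Theta_unit. Qed.

Lemma J_invE : J *m invmx E = - (invmx E *m J^T).
Proof.
apply: (can_inj (mulKmx E_unit)); rewrite mulmxN !mulmxA mulmxV ?E_unit // mul1mx.
by rewrite -[E *m J]opprK -J_E mulNmx -mulmxA mulmxV ?E_unit // mulmx1.
Qed.

Lemma EJ_sym : (E *m J)^T = E *m J.
Proof. by rewrite trmx_mul E_skew mulmxN J_E opprK. Qed.

Lemma EJ_pos (x : 'cV[R]_m) : x != 0 -> 0 < (x^T *m (E *m J) *m x) 0 0.
Proof. by have [_ _ h] := ThetaP => /h; rewrite !mulmxA. Qed.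

Variables (K : fieldExtType rat) (F : {subfield K}).
Variable etahat : {rmorphism subvs_of F -> 'M[rat]_m}.
Hypothesis F_real : totally_real R (subvs_of F).
Hypothesis etahat_im : forall M : 'M[rat]_m,
  map_mx ratr M *m J = J *m map_mx ratr M <-> exists a, etahat a = M.

Lemma etahat_unit a : a != 0 -> etahat a *m etahat a^-1 = 1%:M.
Proof. by move=> a0; rewrite mulmxE -rmorphM divff // rmorph1. Qed.

Lemma J_etahat a : map_mx ratr (etahat a) *m J = J *m map_mx ratr (etahat a).
Proof. by apply/etahat_im; exists a. Qed.

Hypothesis m_gt0 : (0 < m)%N.

(** On a real eigenvector u of x, with eigenvalue a, the relation computes (x
    u)^T (E J) (x u) both as a^2 and as - a^2 times the positive number u^T (E
    J) u; so a = 0, although x is invertible when nonzero. *)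
Lemma rosati_skew x : (etahat x)^T *m Theta = - (Theta *m etahat x) -> x = 0.
Proof.
move=> x_skew; apply/eqP; apply: contraT => x0.
have [|a b||v v0 [rho vE]] :=
  @totally_real_eigenvector R _ m (fun a => (etahat a)^T) F_real m_gt0.
- by move=> a b; rewrite rmorphB linearB.
- by rewrite mulrC rmorphM -mulmxE trmx_mul.
- by rewrite rmorph1 trmx1.
pose X : 'M[R]_m := map_mx ratr (etahat x); pose u := v^T.
have Xu : X *m u = rho x *: u.
  by apply: trmx_inj; rewrite trmx_mul trmxK map_trmx vE linearZ /= trmxK.
have XE : X^T *m E = - (E *m X) by rewrite map_trmx -!map_mxM x_skew map_mxN.
pose s := (u^T *m (E *m J) *m u) 0 0.
have s_gt0 : 0 < s by apply: EJ_pos; rewrite trmx_eq0.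
have e1 : ((X *m u)^T *m (E *m J) *m (X *m u)) 0 0 = rho x ^+ 2 * s.
  have uZ : (rho x *: u)^T = rho x *: u^T by rewrite linearZ.
  by rewrite Xu uZ -!scalemxAl -scalemxAr scalerA mxE expr2.
have e2 : ((X *m u)^T *m (E *m J) *m (X *m u)) 0 0 = - (rho x ^+ 2 * s).
  rewrite trmx_mul -!mulmxA [X^T *m _]mulmxA XE mulNmx -[E *m X *m _]mulmxA.
  rewrite [X *m (J *m _)]mulmxA (J_etahat x) -/X -[J *m X *m _]mulmxA Xu.
  rewrite -[X in - (_ *m (_ *m X))]scalemxAr Xu -!scalemxAr scalerA.
  by rewrite mulmxN -scalemxAr mxE [X in - X]mxE -expr2 /s !mulmxA.
have /eqP : rho x ^+ 2 * s = 0.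
  by move: e2; rewrite e1 => /eqP; rewrite -addr_eq0 -mulr2n mulrn_eq0 => /eqP.
rewrite mulf_eq0 sqrf_eq0 (gt_eqF s_gt0) orbF => /eqP rho0.
case/negP: v0; rewrite -trmx_eq0 -/u -[u]mul1mx.
have <- : map_mx ratr (etahat x^-1) *m X = 1%:M.
  by rewrite /X -map_mxM rmorph_mulmxC etahat_unit // map_mx1.
by rewrite -mulmxA Xu rho0 scale0r mulmx0.
Qed.

(** The Rosati adjoint E^-1 M_a^T E commutes with J, so it is M_b for some b in
    F, and a - b is skew. *)
Lemma rosati_trivial a : (etahat a)^T *m Theta = Theta *m etahat a.
Proof.
have Tu := Theta_unit; have [Tsk _ _] := ThetaP.
have [|b bE] := (etahat_im (invmx Theta *m (etahat a)^T *m Theta)).1.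
  rewrite !map_mxM map_invmx -map_trmx; set X := map_mx _ (etahat a).
  have XJ : X^T *m J^T = J^T *m X^T by rewrite -!trmx_mul J_etahat.
  rewrite [J *m _]mulmxA [J *m _]mulmxA J_invE !mulNmx.
  rewrite -[invmx E *m J^T *m _]mulmxA -XJ mulmxA -!mulmxA -[J^T *m E]opprK.
  by rewrite J_E opprK !mulmxN opprK.
have Tb : Theta *m etahat b = (etahat a)^T *m Theta.
  by rewrite bE !mulmxA mulmxV // mul1mx.
have bT : (etahat b)^T *m Theta = Theta *m etahat a.
  have /(congr1 trmx) := Tb; rewrite !trmx_mul trmxK Tsk mulmxN mulNmx.
  exact: oppr_inj.
suff ab : a = b by rewrite {1}ab bT.
apply/eqP; rewrite -subr_eq0; apply/eqP/rosati_skew.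
by rewrite rmorphB linearB /= mulmxBl mulmxBr bT Tb opprB.
Qed.
End Polarization.

Lemma Fadjoin_sqrt (K : fieldExtType rat) (F : {subfield K}) (q : subvs_of F) (r : K) :
    r ^+ 2 = - vsval q -> <<F; r>>%VS = {:K}%VS ->
  forall c, exists a b : subvs_of F, c = vsval a + vsval b * r.
Proof.
move=> r2 Fr c.
have /Fadjoin_polyP[p pF ->] : c \in <<F; r>>%VS by rewrite Fr memvf.
rewrite horner_coef; elim/big_ind: _ => [|_ _ [a [b ->]] [a' [b' ->]]|i _].
- by exists 0, 0; rewrite !linear0 mul0r addr0.
- by exists (a + a'), (b + b'); rewrite !linearD /= mulrDl addrACA.
have [a ->] : exists a : subvs_of F, p`_i = vsval a.
  by exists (Subvs (polyOverP pF i)).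
elim: (nat_of_ord i) => [|k [x [y IHk]]].
  by exists a, 0; rewrite linear0 mul0r addr0 expr0 mulr1.
exists (- (q * y)), x; rewrite exprSr mulrA IHk mulrDl -mulrA -expr2 r2.
by rewrite rmorphN rmorphM /= addrC mulrN [vsval y * _]mulrC.
Qed.

(** If sigma q is not positive then it is a nonpositive real, sigma r is real,
    and sigma maps K = F + F r into the reals. *)
Lemma sqrt_totally_positive (R : realType) (K : fieldExtType rat)
    (F : {subfield K}) (q : subvs_of F) (r : K) :
    totally_real R (subvs_of F) -> totally_imaginary R K ->
    r ^+ 2 = - vsval q -> <<F; r>>%VS = {:K}%VS ->
  forall sigma : {rmorphism K -> R[i]}, 0 < sigma (vsval q).
Proof.
move=> F_real K_im r2 Fr sg.
have F_re (a : subvs_of F) : complex.Im (sg (vsval a)) = 0.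
  exact: (F_real (sg \o vsval)).
have [c] := K_im sg; apply: contra_notT => q_neg.
have [a [b ->]] := Fadjoin_sqrt r2 Fr c.
have sr2 : sg r ^+ 2 = - sg (vsval q) by rewrite -rmorphXn r2 rmorphN.
have r_re : complex.Im (sg r) = 0.
  have sr2_ge0 : 0 <= sg r ^+ 2.
    rewrite sr2 lecE; have := F_re q; move: q_neg; rewrite ltcE.
    case: (sg (vsval q)) => x y /= + y0; rewrite y0 eqxx oppr0 eqxx /=.
    by rewrite oppr_ge0 leNgt.
  have : sg r ^+ 2 == sqrtC (sg r ^+ 2) ^+ 2 by rewrite sqrtCK.
  have := sr2_ge0; rewrite -sqrtC_ge0 lecE eqf_sqr => /andP[/eqP + _] /orP[]/eqP->.
    by [].
  by case: (sqrtC _) => x y /= ->; rewrite oppr0.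
rewrite rmorphD rmorphM /=; move: (F_re a) (F_re b) r_re.
case: (sg _) => ? ?; case: (sg _) => ? ?; case: (sg _) => ? ? /= -> -> ->.
by rewrite !(mulr0, mul0r, addr0).
Qed.

(** * The action of K *)

Definition pairing_mx (L : pzRingType) (m : nat) : 'M[L]_(m + m) :=
  block_mx 0 1%:M 1%:M 0.

Lemma eq_mx_cols (L : pzRingType) m n (A B : 'M[L]_(m, n)) :
  (forall x : 'cV[L]_n, A *m x = B *m x) -> A = B.
Proof.
move=> AB; apply/matrixP=> i j.
by have /colP/(_ i) := AB (delta_mx j 0); rewrite -!colE !mxE.
Qed.

Lemma pairVE (L : comPzRingType) (m : nat) (x y : 'cV[L]_(m + m)) :
  pairV x y = (x^T *m pairing_mx L m *m y) 0 0.
Proof.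
rewrite /pairV /pairing_mx -[in RHS](vsubmxK x) -[in RHS](vsubmxK y) tr_col_mx.
rewrite mul_row_block.
rewrite !mulmx0 !mulmx1 add0r addr0 mul_row_col [RHS]mxE [LHS]mxE; congr (_ + _).
by rewrite !mxE; apply: eq_bigr => i _; rewrite !mxE mulrC.
Qed.

Lemma XiE (K : fieldExtType rat) (m : nat) (eta : K -> 'M[rat]_(m + m))
    (L : numFieldType) t (x y : 'cV[L]_(m + m)) :
  Xi eta t x y
  = (x^T *m ((map_mx ratr (eta t))^T *m pairing_mx L m) *m y) 0 0.
Proof. by rewrite /Xi pairVE trmx_mul !mulmxA. Qed.

Lemma map_ratr_id m n (N : 'M[rat]_(m, n)) : map_mx ratr N = N.
Proof. by apply/matrixP=> i j; rewrite mxE -(fmorph_eq_rat idfun). Qed.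

Section Eta.
Variables (K : fieldExtType rat) (F : {subfield K}) (m : nat).
Variables (etahat : {rmorphism subvs_of F -> 'M[rat]_m}) (q : subvs_of F) (r : K).
Variables (Theta : 'M[rat]_m) (eta : K -> 'M[rat]_(m + m)).
Hypothesis r2 : r ^+ 2 = - vsval q.
Hypothesis r_gen : <<F; r>>%VS = {:K}%VS.
Hypothesis q0 : q != 0.
Hypothesis Theta_skew : Theta^T = - Theta.
Hypothesis Theta_unit : Theta \in unitmx.
Hypothesis rosati : forall a, (etahat a)^T *m Theta = Theta *m etahat a.
Hypothesis etaP : is_eta etahat q Theta r eta.

(** The matrix of eta r. *)
Definition eta_root : 'M[rat]_(m + m) :=
  block_mx 0 (- ((etahat q)^T *m Theta)) (invmx Theta) 0.

Lemma actV_mul a b : actV (etahat (a * b)) = actV (etahat a) *m actV (etahat b).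
Proof.
rewrite /actV mulmx_block !mulmx0 !mul0mx !addr0 !add0r -trmx_mul rmorph_mulmxC.
by rewrite mulmxE -rmorphM mulrC rmorphM.
Qed.

Lemma actVB a b : actV (etahat (a - b)) = actV (etahat a) - actV (etahat b).
Proof. by rewrite /actV rmorphB linearB opp_block_mx add_block_mx !oppr0 !addr0. Qed.

Lemma actVD a b : actV (etahat (a + b)) = actV (etahat a) + actV (etahat b).
Proof. by rewrite /actV rmorphD linearD add_block_mx !addr0. Qed.

Lemma actV1 : actV (etahat 1) = 1%:M.
Proof. by rewrite /actV rmorph1 trmx1 -scalar_mx_block. Qed.

Lemma eta_root_actV a : eta_root *m actV (etahat a) = actV (etahat a) *m eta_root.
Proof.
rewrite /eta_root /actV !mulmx_block !mulmx0 !mul0mx !addr0 !add0r.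
rewrite mulmxN mulNmx; congr block_mx.
  by rewrite mulmxA -trmx_mul rmorph_mulmxC trmx_mul -!mulmxA rosati.
apply: (can_inj (mulKmx Theta_unit)).
by rewrite !mulmxA mulmxV // mul1mx -rosati -mulmxA mulmxV // mulmx1.
Qed.

Lemma eta_root_sqr : eta_root *m eta_root = - actV (etahat q).
Proof.
rewrite /eta_root /actV !mulmx_block !mulmx0 !mul0mx !addr0 !add0r opp_block_mx.
rewrite !oppr0 mulNmx mulmxN -mulmxA mulmxV // mulmx1 rosati.
by rewrite mulmxA mulVmx // mul1mx.
Qed.

(** Every vector x of V_Q is the first coordinate of a unique w in W, on which
    multiplication by a + b r is explicit; the factor 2 comes from w + iota(w).
    *)
Lemma etaE a b :
  eta (vsval a + vsval b * r) = actV (etahat a) + actV (etahat b) *m eta_root.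
Proof.
apply: eq_mx_cols => x.
(* w is the element of W with first coordinate x. *)
pose xi0 := dsubmx x.
pose xi1 := - (etahat q^-1 *m (invmx Theta *m usubmx x)).
pose w := - scaleVK etahat q 0 1 (col_mx (contractTheta Theta xi0) 0,
                                  col_mx (contractTheta Theta xi1) 0)
          + (col_mx 0 xi0, col_mx 0 xi1).
have qV : etahat q *m etahat q^-1 = 1%:M.
  by rewrite mulmxE -rmorphM divff // rmorph1.
have w1 : w.1 = x.
  rewrite /w /scaleVK /= rmorph0 /actV trmx0 block_mx0 mul0mx sub0r opprK mulr1.
  rewrite mul_block_col !mul0mx mulmx0 !addr0 add_col_mx add0r addr0.
  rewrite /contractTheta Theta_skew mulNmx mulmxN mulmxA rosati /xi1 mulmxN opprK.
  rewrite -mulmxA [etahat q *m _]mulmxA qV mul1mx mulmxA mulmxV // mul1mx.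
  exact: vsubmxK.
have w2 : actV (etahat q) *m w.2 = - (eta_root *m x).
  rewrite /w /scaleVK /= actV1 mul1mx rmorph0 /actV trmx0 block_mx0 mul0mx addr0.
  rewrite opp_col_mx oppr0 add_col_mx addr0 add0r mul_block_col !mul0mx addr0 add0r.
  rewrite /contractTheta Theta_skew mulNmx opprK /eta_root -[in RHS](vsubmxK x).
  rewrite mul_block_col !mul0mx addr0 add0r opp_col_mx mulNmx opprK -mulmxA.
  by rewrite /xi1 mulmxN [etahat q *m (_ *m _)]mulmxA qV mul1mx.
have wW : in_W etahat q Theta w by exists xi0, xi1.
move: w w1 w2 wW => w w1 w2 wW.
have := congr1 fst (etaP a b wW).
rewrite /= w1 -mulr2n -scaler_nat -scalemxAr -[in RHS]mulr2n -scaler_nat.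
move/(scalerI _) => ->; last by [].
rewrite mulrC actV_mul -mulmxA w2 mulmxN opprK mulmxDl mulmxA //.
Qed.

Lemma etaK c : exists a b, c = vsval a + vsval b * r /\
  eta c = actV (etahat a) + actV (etahat b) *m eta_root.
Proof.
have [a [b ->]] := Fadjoin_sqrt r2 r_gen c.
by exists a, b; rewrite etaE.
Qed.

Lemma eta_F a : eta (vsval a) = actV (etahat a).
Proof.
have := etaE a 0; rewrite linear0 mul0r addr0 => ->.
by rewrite rmorph0 /actV trmx0 block_mx0 mul0mx addr0.
Qed.

Lemma eta_r : eta r = eta_root.
Proof.
have := etaE 0 1; rewrite linear0 rmorph1 mul1r add0r => ->.
by rewrite actV1 mul1mx rmorph0 /actV trmx0 block_mx0 add0r.
Qed.

Lemma etaB : zmod_morphism eta.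
Proof.
move=> c d; have [a [b [cE ->]]] := etaK c; have [a' [b' [dE ->]]] := etaK d.
have -> : c - d = vsval (a - a') + vsval (b - b') * r.
  by rewrite cE dE !rmorphB /=; ring.
by rewrite etaE !actVB mulmxBl opprD addrACA.
Qed.

Lemma etaM c d : eta (c * d) = eta c *m eta d.
Proof.
have [a [b [cE ->]]] := etaK c; have [a' [b' [dE ->]]] := etaK d.
have -> : c * d = vsval (a * a' - q * (b * b')) + vsval (a * b' + b * a') * r.
  rewrite cE dE rmorphB !rmorphD !rmorphM /=.
  transitivity (vsval a * vsval a' + vsval b * vsval b' * r ^+ 2
    + (vsval a * vsval b' + vsval b * vsval a') * r); first by ring.
  by rewrite r2; ring.
rewrite etaE actVB actVD !actV_mul mulmxDl mulmxDr !mulmxDl.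
have -> : actV (etahat b) *m eta_root *m actV (etahat a')
    = actV (etahat b) *m actV (etahat a') *m eta_root.
  by rewrite -mulmxA eta_root_actV mulmxA.
have -> : actV (etahat b) *m eta_root *m (actV (etahat b') *m eta_root)
    = - (actV (etahat q) *m (actV (etahat b) *m actV (etahat b'))).
  rewrite -mulmxA (mulmxA eta_root) eta_root_actV -(mulmxA _ eta_root eta_root).
  by rewrite eta_root_sqr !mulmxN -!actV_mul mulrA mulrC.
by rewrite !mulmxA [X in _ + X = _]addrC addrACA [X in _ + X = _]addrC.
Qed.

Lemma eta1 : eta 1 = 1%:M.
Proof. by have := eta_F 1; rewrite rmorph1 actV1. Qed.
End Eta.

(** * The polarization Xi and the complex structure *)

Lemma invmx_skew (L : comUnitRingType) m (A : 'M[L]_m) :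
  A \in unitmx -> A^T = - A -> (invmx A)^T = - invmx A.
Proof.
move=> Au Ask; apply: (can_inj (mulKmx Au)); rewrite mulmxN mulmxV //.
by rewrite -[A in A *m _]opprK -Ask mulNmx -trmx_mul mulVmx // trmx1.
Qed.

Section WeilType.
Variables (R : realType) (m : nat) (J : 'M[R]_m) (Theta : 'M[rat]_m).
Hypothesis JJ : J *m J = - 1%:M.
Hypothesis ThetaP : is_polarization J Theta.
Variables (K : fieldExtType rat) (F : {subfield K}).
Variable etahat : {rmorphism subvs_of F -> 'M[rat]_m}.
Variables (q : subvs_of F) (r : K) (eta : K -> 'M[rat]_(m + m)).
Hypothesis F_real : totally_real R (subvs_of F).
Hypothesis K_im : totally_imaginary R K.
Hypothesis r2 : r ^+ 2 = - vsval q.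
Hypothesis r_gen : <<F; r>>%VS = {:K}%VS.
Hypothesis q0 : q != 0.
Hypothesis J_etahat : forall a,
  map_mx ratr (etahat a) *m J = J *m map_mx ratr (etahat a).
Hypothesis rosati : forall a, (etahat a)^T *m Theta = Theta *m etahat a.
Hypothesis etaP : is_eta etahat q Theta r eta.

Local Notation E := (map_mx ratr Theta : 'M[R]_m).
Local Notation Xq := (map_mx ratr (etahat q) : 'M[R]_m).
Local Notation I := (block_mx J^T 0 0 (- J)).

Let Theta_skew : Theta^T = - Theta. Proof. by case: ThetaP. Qed.
Let T_unit := Theta_unit ThetaP.
Let EU := E_unit ThetaP.
Let etaKK := etaK r2 r_gen q0 Theta_skew T_unit rosati etaP.
Let etaBB := etaB r2 r_gen q0 Theta_skew T_unit rosati etaP.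
Let etaMM := etaM r2 r_gen q0 Theta_skew T_unit rosati etaP.
Let eta11 := eta1 q0 Theta_skew T_unit rosati etaP.
Let etaFF := eta_F q0 Theta_skew T_unit rosati etaP.
Let etarr := eta_r q0 Theta_skew T_unit rosati etaP.

Lemma cx_sqr : I *m I = - 1%:M.
Proof.
rewrite mulmx_block !mulmx0 !mul0mx !addr0 !add0r -trmx_mul mulNmx mulmxN opprK JJ.
by rewrite linearN /= trmx1 scalar_mx_block opp_block_mx oppr0.
Qed.

Lemma J_etahat_tr a :
  (map_mx ratr (etahat a))^T *m J^T = J^T *m (map_mx ratr (etahat a))^T.
Proof. by rewrite -!trmx_mul J_etahat. Qed.

Lemma rosatiR a :
  (map_mx ratr (etahat a))^T *m E = E *m map_mx ratr (etahat a).
Proof. by rewrite map_trmx -!map_mxM rosati. Qed.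

Lemma actV_cx a :
  map_mx ratr (actV (etahat a)) *m I = I *m map_mx ratr (actV (etahat a)).
Proof.
rewrite /actV map_block_mx !map_mx0 -map_trmx !mulmx_block.
rewrite !mulmx0 !mul0mx !addr0 !add0r J_etahat_tr.
by rewrite mulmxN mulNmx J_etahat.
Qed.

Lemma eta_root_cx :
  map_mx ratr (eta_root etahat q Theta) *m I
  = I *m map_mx ratr (eta_root etahat q Theta).
Proof.
rewrite /eta_root map_block_mx !map_mx0 map_mxN map_mxM map_invmx -map_trmx.
rewrite !mulmx_block !mulmx0 !mul0mx !addr0 !add0r.
rewrite !mulNmx (J_invE JJ ThetaP) opprK mulmxN opprK mulmxN mulmxA -J_etahat_tr.
by rewrite -!mulmxA (J_E JJ ThetaP) mulmxN opprK.
Qed.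

Lemma eta_cx c : map_mx ratr (eta c) *m I = I *m map_mx ratr (eta c).
Proof.
have [a [b [_ ->]]] := etaKK c.
rewrite map_mxD map_mxM mulmxDl mulmxDr actV_cx; congr (_ + _).
by rewrite -mulmxA eta_root_cx mulmxA actV_cx mulmxA.
Qed.

Lemma etaN c : eta (- c) = - eta c.
Proof. by have := etaBB 0 c; have := etaBB 0 0; rewrite !subrr !sub0r => ->; rewrite sub0r. Qed.

Lemma Xi_gram :
  (eta (- r))^T *m pairing_mx rat m
  = block_mx (invmx Theta) 0 0 (- (Theta *m etahat q)).
Proof.
rewrite etaN etarr /eta_root /pairing_mx linearN /= tr_block_mx !trmx0.
rewrite mulNmx mulmx_block !mulmx0 !mul0mx !mulmx1 !addr0 !add0r opp_block_mx.
rewrite !oppr0 linearN /= opprK trmx_mul trmxK Theta_skew mulNmx.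
by rewrite invmx_skew // opprK.
Qed.

Lemma Xi_gramR :
  (map_mx ratr (eta (- r)))^T *m pairing_mx R m
  = block_mx (invmx E) 0 0 (- (E *m Xq)).
Proof.
have -> : pairing_mx R m = map_mx ratr (pairing_mx rat m).
  by rewrite /pairing_mx map_block_mx !map_mx0 map_mx1.
rewrite map_trmx -map_mxM Xi_gram map_block_mx !map_mx0 map_mxN map_mxM.
by rewrite map_invmx.
Qed.

Lemma Xi_gram_cx :
  ((map_mx ratr (eta (- r)))^T *m pairing_mx R m) *m I
  = block_mx (invmx E *m J^T) 0 0 (E *m J *m Xq).
Proof.
rewrite Xi_gramR mulmx_block !mulmx0 !mul0mx !addr0 !add0r mulNmx mulmxN opprK.
by rewrite -!mulmxA J_etahat.
Qed.

Lemma Xq_adj : Xq^T *m (E *m J) = (E *m J) *m Xq.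
Proof. by rewrite mulmxA rosatiR -!mulmxA J_etahat. Qed.

Lemma Xi_gram_cx_sym :
  (block_mx (invmx E *m J^T) 0 0 (E *m J *m Xq))^T
  = block_mx (invmx E *m J^T) 0 0 (E *m J *m Xq).
Proof.
rewrite tr_block_mx !trmx0 !trmx_mul trmxK; congr block_mx.
  by rewrite (invmx_skew EU (E_skew ThetaP)) mulmxN (J_invE JJ ThetaP) opprK.
by rewrite -trmx_mul (EJ_sym JJ ThetaP) Xq_adj.
Qed.

(** An eigenvalue z of M_q is sigma q for some embedding sigma of K: the
    z-eigenspace of eta q on V_C is stable under eta K, hence contains a joint
    eigenvector, whose character sends q to z. *)
Lemma Xq_pos (x : 'cV[R]_m) : x != 0 -> 0 < (x^T *m (E *m J) *m (Xq *m x)) 0 0.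
Proof.
apply: (self_adjoint_pos (EJ_pos ThetaP) Xq_adj) => z.
rewrite map_ratrC => /eigenvalueP[v vz v0].
pose W := eigenspace (map_mx ratr (eta (vsval q)) : 'M[R[i]]_(m + m)) z.
have W0 : W != 0.
  apply/eigenvalueP; exists (row_mx 0 v); last first.
    by rewrite row_mx_eq0 negb_and v0 orbT.
  rewrite etaFF /actV map_block_mx !map_mx0 mul_row_block !mul0mx mulmx0 addr0 add0r.
  by rewrite vz scale_row_mx scaler0.
have [|u u0 [sg [/eigenspaceP uW sE]]] := eigen_character_in etaBB etaMM eta11 W0.
  move=> c; apply: comm_mx_stable_eigenspace.
  by rewrite /comm_mx -!map_mxM -!etaMM mulrC.
have <- : sg (vsval q) = z.
  have /eqP : (sg (vsval q) - z) *: u = 0 by rewrite scalerBl -sE uW subrr.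
  by rewrite scaler_eq0 (negPf u0) orbF subr_eq0 => /eqP.
exact: (sqrt_totally_positive F_real K_im r2 r_gen).
Qed.

(** On the first summand write w = E u: both blocks are then governed by the
    positive form E J. *)
Lemma Xi_gram_cx_pos (x : 'cV[R]_(m + m)) : x != 0 ->
  0 < (x^T *m block_mx (invmx E *m J^T) 0 0 (E *m J *m Xq) *m x) 0 0.
Proof.
rewrite -[x]vsubmxK; move: (usubmx x) (dsubmx x) => w th x0.
rewrite tr_col_mx mul_row_block !mulmx0 addr0 add0r mul_row_col mxE.
pose u := invmx E *m w.
have wE : w = E *m u by rewrite /u mulmxA mulmxV // mul1mx.
have -> : w^T *m (invmx E *m J^T) *m w = u^T *m (E *m J) *m u.
  rewrite wE trmx_mul (E_skew ThetaP) mulmxN !mulNmx -!mulmxA.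
  rewrite [E *m (invmx E *m _)]mulmxA mulmxV // mul1mx [J^T *m (E *m u)]mulmxA.
  by rewrite (J_E JJ ThetaP) mulNmx mulmxN opprK !mulmxA.
have -> : th^T *m (E *m J *m Xq) *m th = th^T *m (E *m J) *m (Xq *m th).
  by rewrite !mulmxA.
have [th0|th0] := eqVneq th 0.
  rewrite th0 !mulmx0 [X in _ + X]mxE addr0; apply: (EJ_pos ThetaP).
  apply: contra x0 => /eqP u0; rewrite th0 wE u0 mulmx0 col_mx0 //.
rewrite ltr_wpDl ?Xq_pos //.
have [->|u0] := eqVneq u 0; first by rewrite mulmx0 mxE.
by rewrite ltW // (EJ_pos ThetaP).
Qed.

Lemma Xi_positive_cx : Xi_positive eta (- r) I.
Proof.
have XE (x y : 'cV[R]_(m + m)) : Xi eta (- r) x (I *m y)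
    = (x^T *m block_mx (invmx E *m J^T) 0 0 (E *m J *m Xq) *m y) 0 0.
  by rewrite XiE mulmxA -[_ *m I]mulmxA Xi_gram_cx.
split=> [x y|x x0]; rewrite !XE; last exact: Xi_gram_cx_pos.
rewrite -[RHS]trace_mx11 -mxtrace_tr trace_mx11 !trmx_mul trmxK Xi_gram_cx_sym.
by rewrite mulmxA.
Qed.

Lemma Xi_skew (x y : 'cV[rat]_(m + m)) : Xi eta (- r) x y = - Xi eta (- r) y x.
Proof.
rewrite !XiE map_ratr_id Xi_gram.
set N := block_mx _ _ _ _.
have Nsk : N^T = - N.
  rewrite tr_block_mx !trmx0 opp_block_mx !oppr0 invmx_skew //; congr block_mx.
  by rewrite linearN /= trmx_mul Theta_skew mulmxN rosati.
rewrite -[LHS]trace_mx11 -mxtrace_tr trace_mx11 !trmx_mul trmxK Nsk mulNmx mulmxN.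
by rewrite mxE mulmxA.
Qed.

Lemma Xi_cx (x y : 'cV[R]_(m + m)) : Xi eta (- r) (I *m x) (I *m y) = Xi eta (- r) x y.
Proof.
rewrite !XiE trmx_mul.
transitivity ((x^T *m (I^T *m ((map_mx ratr (eta (- r)))^T *m pairing_mx R m *m I)) *m y) 0 0).
  by rewrite !mulmxA.
congr ((_ *m _ *m _) 0 0); rewrite Xi_gram_cx Xi_gramR.
rewrite tr_block_mx !trmx0 trmxK mulmx_block !mulmx0 !mul0mx !addr0 !add0r.
congr block_mx.
  by rewrite mulmxA (J_invE JJ ThetaP) mulNmx -mulmxA -trmx_mul JJ linearN /= trmx1 mulmxN mulmx1 opprK.
rewrite linearN /= mulNmx !mulmxA (J_E JJ ThetaP) !mulNmx opprK.
by rewrite -[E *m J *m J]mulmxA JJ mulmxN mulmx1 mulNmx.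
Qed.

Lemma Xi_rosati (iota : {rmorphism K -> K}) :
    (forall a, a \in F -> iota a = a) -> iota r = - r ->
  forall a (x y : 'cV[rat]_(m + m)),
    Xi eta (- r) (eta a *m x) y = Xi eta (- r) x (eta (iota a) *m y).
Proof.
move=> iotaF iota_r c x y; rewrite !XiE map_ratr_id trmx_mul.
have adjF a : (actV (etahat a))^T *m pairing_mx rat m
    = pairing_mx rat m *m actV (etahat a).
  rewrite /actV /pairing_mx tr_block_mx trmxK !trmx0 !mulmx_block.
  by rewrite !mulmx0 !mul0mx !mulmx1 !mul1mx !addr0 !add0r.
have adj_r : (eta_root etahat q Theta)^T *m pairing_mx rat m
    = - (pairing_mx rat m *m eta_root etahat q Theta).
  have := Xi_gram; rewrite etaN etarr linearN /= mulNmx => /(canRL (@opprK _)) ->.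
  rewrite /eta_root /pairing_mx mulmx_block !mulmx0 !mul0mx !mul1mx !addr0 !add0r.
  by rewrite rosati.
have adj : (eta c)^T *m pairing_mx rat m = pairing_mx rat m *m eta (iota c).
  have [a [b [cE ->]]] := etaKK c.
  have -> : iota c = vsval a + vsval (- b) * r.
    rewrite cE rmorphD rmorphM iota_r !iotaF ?subvsP // rmorphN /=.
    by rewrite mulrN mulNr.
  rewrite (etaE q0 Theta_skew T_unit rosati etaP) linearD /= trmx_mul mulmxDl mulmxDr.
  rewrite adjF; congr (_ + _).
  have -> : actV (etahat (- b)) = - actV (etahat b).
    by rewrite -!etaFF rmorphN etaN.
  rewrite -mulmxA adjF mulmxA adj_r !mulNmx -mulmxA -eta_root_actV //.
  by rewrite mulmxN.
congr (_ 0 0); rewrite -!mulmxA; congr (_ *m _).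
rewrite !mulmxA -trmx_mul -etaMM mulrC etaMM trmx_mul.
by rewrite -[X in X *m _ = _]mulmxA adj !mulmxA.
Qed.
End WeilType.

(** * Modules over a number field *)

Section Module.
Variables (L : fieldExtType rat) (m : nat) (f : {rmorphism L -> 'M[rat]_m}).

Definition comb k (u : 'I_k -> 'cV[rat]_m) (x : {ffun 'I_k -> L}) : 'cV[rat]_m :=
  \sum_i f (x i) *m u i.

(** Ring morphisms out of L are automatically linear over the rationals. *)
Lemma moduleZ (a : rat) x : f (a *: x) = a *: f x.
Proof. by apply: rat_linear => y z; rewrite rmorphB. Qed.

Fact comb_is_linear k (u : 'I_k -> 'cV[rat]_m) : linear (comb u).
Proof.
move=> a x y; rewrite /comb scaler_sumr -big_split; apply: eq_bigr => i _ /=.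
by rewrite !ffunE rmorphD moduleZ mulmxDl -scalemxAl.
Qed.
HB.instance Definition _ k u :=
  GRing.isLinear.Build rat {ffun 'I_k -> L} 'cV[rat]_m *:%R (@comb k u)
    (comb_is_linear u).

Definition free_over k (u : 'I_k -> 'cV[rat]_m) := forall x, comb u x = 0 -> x = 0.

Definition span_over k (u : 'I_k -> 'cV[rat]_m) : {vspace 'cV[rat]_m} :=
  limg (linfun (comb u)).

Lemma span_overP k (u : 'I_k -> 'cV[rat]_m) v :
  reflect (exists x, v = comb u x) (v \in span_over u).
Proof.
apply: (iffP memv_imgP) => [[x _ ->]|[x ->]]; first by exists x; rewrite lfunE.
by exists x; rewrite ?memvf // lfunE.
Qed.

Lemma dim_span_over k (u : 'I_k -> 'cV[rat]_m) :
  free_over u -> \dim (span_over u) = (k * \dim {:L})%N.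
Proof.
move=> u_free; rewrite limg_dim_eq; last first.
  apply/eqP; rewrite -subv0; apply/subvP=> x.
  rewrite memv_cap memvf memv_ker lfunE memv0 /= => /eqP/u_free->//.
by rewrite !dimvf /dim /= card_ord.
Qed.

Lemma dim_cV : \dim {: 'cV[rat]_m} = m.
Proof. by rewrite dimvf /dim /= muln1. Qed.

Definition cons_fam k (v : 'cV[rat]_m) (u : 'I_k -> 'cV[rat]_m) : 'I_k.+1 -> 'cV[rat]_m :=
  fun i => if unlift ord0 i is Some j then u j else v.

Lemma cons_fam0 k v (u : 'I_k -> 'cV[rat]_m) : cons_fam v u ord0 = v.
Proof. by rewrite /cons_fam unlift_none. Qed.

Lemma cons_famS k v (u : 'I_k -> 'cV[rat]_m) j : cons_fam v u (lift ord0 j) = u j.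
Proof. by rewrite /cons_fam liftK. Qed.

Lemma comb_mul k (u : 'I_k -> 'cV[rat]_m) a (x : {ffun 'I_k -> L}) :
  comb u [ffun i => a * x i] = f a *m comb u x.
Proof.
rewrite /comb mulmx_sumr; apply: eq_bigr => i _.
by rewrite ffunE rmorphM -mulmxE mulmxA.
Qed.

(** L is a field: a relation with a nonzero coefficient on v puts v in the span.
    *)
Lemma free_cons k v (u : 'I_k -> 'cV[rat]_m) :
  free_over u -> v \notin span_over u -> free_over (cons_fam v u).
Proof.
move=> u_free v_u x; pose y := [ffun j => x (lift ord0 j)].
have -> : comb (cons_fam v u) x = f (x ord0) *m v + comb u y.
  rewrite /comb big_ord_recl cons_fam0; congr (_ + _); apply: eq_bigr => j _.
  by rewrite cons_famS ffunE.
have [x0|x0] := eqVneq (x ord0) 0.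
  rewrite x0 rmorph0 mul0mx add0r => /u_free y0; apply/ffunP=> i; rewrite ffunE.
  by case: (unliftP ord0 i) => [j ->|->//]; move/ffunP/(_ j): y0; rewrite !ffunE.
move/eqP; rewrite addr_eq0 => /eqP vE; case/negP: v_u; apply/span_overP.
exists [ffun i => - (x ord0)^-1 * y i]; rewrite comb_mul rmorphN mulNmx -mulmxN -vE.
by rewrite mulmxA mulmxE -rmorphM mulVf // rmorph1 mul1mx.
Qed.

Variable d : nat.
Hypothesis m_dim : m = (d * \dim {:L})%N.

Lemma exists_free k : (k <= d)%N -> exists u : 'I_k -> 'cV[rat]_m, free_over u.
Proof.
elim: k => [_|k IHk kd].
  by exists (fun=> 0) => x _; apply/ffunP=> -[].
have [u u_free] := IHk (ltnW kd).
have /subvPn[v _ v_u] : ~~ (fullv <= span_over u)%VS.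
  apply/negP=> /dimvS; rewrite dim_cV dim_span_over // m_dim.
  by rewrite leq_pmul2r ?adim_gt0 // leqNgt kd.
by exists (cons_fam v u); apply: free_cons.
Qed.

Lemma exists_basis : exists u : 'I_d -> 'cV[rat]_m,
  free_over u /\ forall v, exists x, v = comb u x.
Proof.
have [u u_free] := exists_free (leqnn d); exists u; split=> // v.
apply/span_overP; suff -> : span_over u = fullv by rewrite memvf.
apply/eqP; rewrite eqEdim subvf /=.
by rewrite [X in (X <= _)%N]dim_cV dim_span_over // -m_dim.
Qed.

Variable Theta : 'M[rat]_m.
Hypothesis Theta_skew : Theta^T = - Theta.
Hypothesis Theta_adj : forall a, (f a)^T *m Theta = Theta *m f a.

Definition isotropic k (u : 'I_k -> 'cV[rat]_m) :=
  forall i j a, (u i)^T *m Theta *m (f a *m u j) = 0.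

Lemma skew_self a (v : 'cV[rat]_m) : v^T *m Theta *m (f a *m v) = 0.
Proof.
set s := LHS; have : s^T = - s.
  rewrite /s !trmx_mul trmxK Theta_skew mulNmx mulmxN -!mulmxA.
  by rewrite [(f a)^T *m _]mulmxA Theta_adj !mulmxA.
rewrite [s]mx11_scalar tr_scalar_mx => /matrixP/(_ 0 0); rewrite !mxE !mulr1n.
by move/eqP; rewrite -addr_eq0 -mulr2n mulrn_eq0 /= => /eqP->; rewrite raddf0.
Qed.

(** For k < d / 2 the orthogonal of the span of u, of codimension at most k [L :
    Q], is too large to be contained in the span, and any of its vectors outside
    of the span can be added: the line it generates is isotropic by [skew_self].
    *)
Lemma exists_isotropic k : (k.*2 <= d)%N ->
  exists u : 'I_k -> 'cV[rat]_m, free_over u /\ isotropic u.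
Proof.
elim: k => [_|k IHk kd].
  by exists (fun=> 0); split=> [x _|[]//]; apply/ffunP=> -[].
have [|u [u_free u_iso]] := IHk; first by apply: leq_trans kd; rewrite leq_double.
(* The rows of Y are a basis of the span, so lker g is its orthogonal. *)
pose Y : 'M[rat]_(\dim (span_over u), m) := \matrix_i ((vbasis (span_over u))`_i)^T.
pose g := mulmx (Y *m Theta) : 'cV[rat]_m -> 'cV[rat]_(\dim (span_over u)).
have [v v_perp v_u] : exists2 v, v \in lker (linfun g) & v \notin span_over u.
  apply/subvPn/negP=> /dimvS.
  have := limg_ker_dim (linfun g) fullv; rewrite capfv dim_cV => dim_g.
  have : (\dim (limg (linfun g)) <= \dim (span_over u))%N.
    by apply: leq_trans (dimvS (subvf _)) _; rewrite dimvf /dim /= muln1.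
  have ku := eq_leq (dim_span_over u_free).
  move=> /leq_trans/(_ ku) le_g /leq_trans/(_ ku) le_k.
  have : (d * \dim {:L} <= k.*2 * \dim {:L})%N.
    by rewrite -m_dim -dim_g -addnn mulnDl leq_add.
  rewrite leq_pmul2r ?adim_gt0 // leqNgt.
  by move: kd; rewrite doubleS => /ltnW ->.
have perp x : x \in span_over u -> x^T *m Theta *m v = 0.
  move: v_perp; rewrite memv_ker lfunE /= /g => /eqP v0.
  move=> xU; rewrite (coord_vbasis xU) linear_sum !mulmx_suml big1 // => i _ /=.
  have /row_matrixP/(_ i) := v0; rewrite !row_mul row0 rowK => vi.
  by rewrite linearZ /= -!scalemxAl vi scaler0.
have u_span i a : f a *m u i \in span_over u.
  apply/span_overP; exists [ffun j => if j == i then a else 0].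
  rewrite /comb (bigD1 i) //= ffunE eqxx big1 ?addr0 // => j /negPf ji.
  by rewrite ffunE ji rmorph0 mul0mx.
exists (cons_fam v u); split; first exact: free_cons.
move=> i j a; case: (unliftP ord0 i) => [i' ->|->]; case: (unliftP ord0 j) => [j' ->|->];
  rewrite ?cons_fam0 ?cons_famS //; last exact: skew_self.
  rewrite mulmxA -[_ *m Theta *m _]mulmxA -Theta_adj mulmxA -trmx_mul.
  exact: perp (u_span _ _).
apply: trmx_inj; rewrite trmx0 trmx_mul [(v^T *m Theta)^T]trmx_mul trmxK Theta_skew.
by rewrite mulNmx mulmxN mulmxA perp ?u_span // oppr0.
Qed.
End Module.

(** * Eigenspaces of the complex structure *)

Lemma rmorph_ratZ (L : fieldExtType rat) (C : numFieldType) (sg : {rmorphism L -> C})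
  (a : rat) x : sg (a *: x) = ratr a * sg x.
Proof.
rewrite -[a *: x]mulr_algl rmorphM; congr (_ * _).
exact: (fmorph_eq_rat (sg \o in_alg L)).
Qed.

Section Frame.
Variables (L : fieldExtType rat) (m d : nat) (f : {rmorphism L -> 'M[rat]_m}).
Hypothesis m_dim : m = (d * \dim {:L})%N.
Variables (C : numFieldType) (sg : {rmorphism L -> C}).

(** In an L-basis u of Q^m, let x k be the coordinates of the k-th unit vector.
    The rows sg (x k j), for fixed j, are sg-eigenvectors of L, and V, whose
    columns are the u j, both certifies their independence and gives the
    coordinates of any other eigenvector. *)
Lemma character_frame : exists (N : 'M[C]_(d, m)) (V : 'M[rat]_(m, d)),
  [/\ N *m map_mx ratr V = 1%:M,
      forall a, N *m map_mx ratr (f a) = sg a *: N,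
      forall p (W : 'M[C]_(p, m)),
        (forall a, W *m map_mx ratr (f a) = sg a *: W) ->
        W = W *m map_mx ratr V *m N
    & forall i j, exists a, N i j = sg a].
Proof.
have [u [u_free u_gen]] := exists_basis f m_dim.
have [x xE] := fin_all_exists (fun k : 'I_m => u_gen (delta_mx k 0)).
pose X (v : 'cV[rat]_m) := \sum_k v k 0 *: x k.
have XE v : comb f u (X v) = v.
  rewrite /X linear_sum [RHS]matrix_sum_delta; apply: eq_bigr => k _ /=.
  by rewrite linearZ /= -xE big_ord1.
have X_uniq v y : v = comb f u y -> X v = y.
  move=> vE; apply/eqP; rewrite -subr_eq0; apply/eqP/u_free.
  by rewrite linearB /= XE vE subrr.
pose N : 'M[C]_(d, m) := \matrix_(j, k) sg (x k j).
have NE (v : 'cV[rat]_m) j : (N *m map_mx ratr v) j 0 = sg (X v j).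
  rewrite mxE /X sum_ffunE rmorph_sum; apply: eq_bigr => k _ /=.
  by rewrite !mxE ffunE rmorph_ratZ mulrC.
have XM a v : X (f a *m v) = [ffun i => a * X v i].
  by apply: X_uniq; rewrite comb_mul XE.
have comb1 l : u l = comb f u [ffun i => (i == l)%:R].
  rewrite /comb (bigD1 l) //= ffunE eqxx rmorph1 mul1mx big1 ?addr0 // => i /negPf il.
  by rewrite ffunE il rmorph0 mul0mx.
exists N, (\matrix_(k, j) u j k 0); split.
- apply/matrixP=> j l; rewrite [RHS]mxE.
  transitivity ((N *m map_mx ratr (u l)) j 0).
    by rewrite !mxE; apply: eq_bigr => k _; rewrite !mxE.
  by rewrite NE (X_uniq _ _ (comb1 l)) ffunE rmorph_nat.
- move=> a; apply/matrixP=> j k; rewrite [RHS]mxE.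
  transitivity ((N *m map_mx ratr (f a *m (delta_mx k 0 : 'cV_m))) j 0).
    by rewrite map_mxM mulmxA map_delta_mx -colE [RHS]mxE.
  by rewrite NE XM ffunE rmorphM (X_uniq _ _ (xE k)) mxE.
- move=> p W WE; apply/matrixP=> i k.
  have -> : W i k = (W *m map_mx ratr (delta_mx k 0 : 'cV[rat]_m)) i 0.
    by rewrite map_delta_mx -colE mxE.
  rewrite xE /comb raddf_sum mulmx_sumr summxE [RHS]mxE; apply: eq_bigr => j _ /=.
  rewrite map_mxM mulmxA WE -scalemxAl mxE [N j k]mxE mulrC; congr (_ * _).
  by rewrite !mxE; apply: eq_bigr => l _; rewrite !mxE.
- by move=> j k; exists (x k j); rewrite mxE.
Qed.
End Frame.

Lemma has_dim_row_free (C : fieldType) k N (Y : 'M[C]_(k, N)) (P : 'cV[C]_N -> Prop) :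
    row_free Y -> (forall v, P v <-> exists g : 'rV_k, v = (g *m Y)^T) ->
  has_dim P k.
Proof.
move=> Yfree PE.
pose h (g : 'rV[C]_k) := (g *m Y)^T.
have h_lin : linear h by move=> a x y; rewrite /h mulmxDl -scalemxAl linearP.
pose hM := GRing.isLinear.Build C 'rV[C]_k 'cV[C]_N *:%R h h_lin.
pose hl : {linear 'rV[C]_k -> 'cV[C]_N} := HB.pack h hM.
exists (limg (linfun hl)) => [v|].
  split=> [/memv_imgP[g _ ->]|/PE[g ->]]; first by apply/PE; exists g; rewrite (lfunE hl).
  by apply/memv_imgP; exists g; rewrite ?memvf // (lfunE hl).
rewrite limg_dim_eq ?dimvf /dim /= ?mul1n //.
apply/eqP; rewrite -subv0; apply/subvP=> g.
rewrite memv_cap memvf memv_ker (lfunE hl) memv0 /= /h trmx_eq0 /=.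
by rewrite mulmx_free_eq0.
Qed.

Section Balanced.
Variables (R : rcfType) (d : nat) (A : 'M[R[i]]_d).
Hypothesis AA : A *m A = - 1%:M.
Hypothesis A_real : map_mx (@conjc R) A = A.

(** The ranks of A - e and A + e add up to d, because the product of these
    matrices vanishes and their difference is invertible; conjugation exchanges
    them. *)
Lemma rank_eigenspace_i e :
  e ^+ 2 = -1 -> conjc e = - e -> \rank (kermx (A - e%:M)) = d./2.
Proof.
move=> e2 ec.
have e0 : e != 0.
  by apply: contra_eq_neq e2 => ->; rewrite expr0n eq_sym oppr_eq0 oner_eq0.
have conj_rank : \rank (A + e%:M)%R = \rank (A - e%:M)%R.
  rewrite -(mxrank_map (@conjc R) (A - e%:M)) map_mxB A_real map_scalar_mx.
  rewrite /= ec; congr mxrank; apply/matrixP=> i j; rewrite !mxE mulNrn opprK //.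
have le_d : (\rank (A - e%:M)%R + \rank (A + e%:M)%R <= d)%N.
  apply: mulmx0_rank_max; rewrite mulmxBl !mulmxDr AA !mul_scalar_mx mul_mx_scalar.
  rewrite scale_scalar_mx -expr2 e2.
  by apply/matrixP=> i j; rewrite !mxE mulNrn; ring.
have ge_d : (d <= \rank (A + e%:M)%R + \rank (A - e%:M)%R)%N.
  have e2_neq0 : e *+ 2 != 0 by rewrite mulrn_eq0.
  rewrite -[X in (X <= _)%N](@mxrank1 R[i] d) -[\rank 1%:M](mxrank_scale_nz _ e2_neq0).
  rewrite -[\rank (A - _)]mxrank_opp; apply: leq_trans (mxrank_add _ _).
  apply: eq_leq; congr mxrank; apply/matrixP=> i j; by rewrite !mxE; case: (i == j); rewrite /= ?mulr1n ?mulr0n; ring.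
rewrite mxrank_ker; move: le_d ge_d; rewrite conj_rank addnn => le_d ge_d.
have dE : d = (\rank (A - e%:M)%R).*2 by apply/eqP; rewrite eqn_leq ge_d.
by move: (\rank _) dE => k ->; rewrite doubleK -addnn addnK.
Qed.
End Balanced.

Section BalancedEigenspaces.
Variables (R : realType) (m d : nat) (J : 'M[R]_m) (Theta : 'M[rat]_m).
Hypothesis JJ : J *m J = - 1%:M.
Hypothesis ThetaP : is_polarization J Theta.
Variables (K : fieldExtType rat) (F : {subfield K}).
Variable etahat : {rmorphism subvs_of F -> 'M[rat]_m}.
Variables (q : subvs_of F) (r : K) (eta : K -> 'M[rat]_(m + m)).
Hypothesis m_dim : m = (d * \dim {: subvs_of F})%N.
Hypothesis F_real : totally_real R (subvs_of F).
Hypothesis r2 : r ^+ 2 = - vsval q.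
Hypothesis r_gen : <<F; r>>%VS = {:K}%VS.
Hypothesis q0 : q != 0.
Hypothesis J_etahat : forall a,
  map_mx ratr (etahat a) *m J = J *m map_mx ratr (etahat a).
Hypothesis rosati : forall a, (etahat a)^T *m Theta = Theta *m etahat a.
Hypothesis etaP : is_eta etahat q Theta r eta.

Local Notation I := (block_mx J^T 0 0 (- J)).
Local Notation toC := (map_mx (real_complex R)).

Let Theta_skew : Theta^T = - Theta. Proof. by case: ThetaP. Qed.
Let T_unit := Theta_unit ThetaP.
Let etaEE := etaE q0 Theta_skew T_unit rosati etaP.
Let etaFF := eta_F q0 Theta_skew T_unit rosati etaP.
Let etarr := eta_r q0 Theta_skew T_unit rosati etaP.

(** A vector (w, th) of V_sigma satisfies E^-1 w = sigma(r) th, so it is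
    determined by its component w in the sigma-part of H^1(X, C). In the frame N
    of that part, right multiplication by J becomes the matrix A. *)
Lemma eigenspace_dim (sigma : {rmorphism K -> R[i]}) (e : R[i]) :
    e ^+ 2 = -1 -> conjc e = - e ->
  has_dim (fun v => in_Vsigma eta sigma v /\ toC I *m v = e *: v) d./2.
Proof.
move=> e2 ec.
have [N [V [NV Nf NW Nsg]]] :=
  character_frame etahat m_dim (sigma \o vsval : {rmorphism subvs_of F -> R[i]}).
pose JC := toC J; pose EC : 'M[R[i]]_m := map_mx ratr Theta.
pose VC : 'M[R[i]]_(m, d) := map_mx ratr V.
have ECu : EC \in unitmx by rewrite map_unitmx.
have JCf a : map_mx ratr (etahat a) *m JC = JC *m map_mx ratr (etahat a).
  by rewrite -map_ratrC -!map_mxM J_etahat.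
have JCE : JC *m invmx EC = - (invmx EC *m JC^T).
  rewrite /EC -map_ratrC -map_invmx /JC map_trmx -!map_mxM.
  by rewrite (J_invE JJ ThetaP) map_mxN.
pose A := N *m JC *m VC.
have NJ : N *m JC = A *m N.
  by apply: NW => a; rewrite -mulmxA -JCf mulmxA Nf -scalemxAl.
have AA : A *m A = - 1%:M.
  rewrite {2}/A !mulmxA -NJ -(mulmxA N JC JC) -map_mxM JJ map_mxN map_mx1.
  by rewrite mulmxN mulmx1 mulNmx NV.
have A_real : map_mx (@conjc R) A = A.
  rewrite /A !map_mxM; congr (_ *m _ *m _); apply/matrixP=> i j; rewrite !mxE.
  - have [a ->] := Nsg i j; have := F_real (sigma \o vsval) a => /=.
    by case: (sigma _) => x y /= ->; rewrite oppr0.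
  - exact: conjc_real.
  - exact: fmorph_rat.
pose sr := sigma r.
have sr2 : sr ^+ 2 = - sigma (vsval q) by rewrite -rmorphXn r2 rmorphN.
have sr0 : sr != 0.
  apply: contra_neq q0 => sr0.
  apply: (fmorph_inj (sigma \o vsval : {rmorphism subvs_of F -> R[i]})).
  by apply: oppr_inj; rewrite rmorph0 oppr0 /= -sr2 sr0 expr0n.
pose Y0 : 'M[R[i]]_(d, m + m) := row_mx N (N *m (sr^-1 *: invmx EC)^T).
have Y0free : row_free Y0.
  by apply/row_freeP; exists (col_mx VC 0); rewrite mul_row_col NV mulmx0 addr0.
pose Z := kermx (A - e%:M).
rewrite -(rank_eigenspace_i AA A_real e2 ec) -/Z.
apply: (@has_dim_row_free _ _ _ (row_base Z *m Y0)).
  by rewrite /row_free mxrankMfree // [_ == _]row_base_free.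
have fT a (g : 'rV_d) : (map_mx ratr (etahat a))^T *m (g *m N)^T
    = sigma (vsval a) *: (g *m N)^T.
  by rewrite -trmx_mul -mulmxA Nf -scalemxAr linearZ.
have actVE a w th : map_mx ratr (actV (etahat a)) *m col_mx w th
    = col_mx ((map_mx ratr (etahat a))^T *m w) (map_mx ratr (etahat a) *m th)
    :> 'cV[R[i]]_(m + m).
  rewrite /actV map_block_mx !map_mx0 -map_trmx mul_block_col !mul0mx.
  by rewrite addr0 add0r.
have rootE w th : map_mx ratr (eta_root etahat q Theta) *m col_mx w th
    = col_mx (- ((map_mx ratr (etahat q))^T *m (EC *m th))) (invmx EC *m w)
    :> 'cV[R[i]]_(m + m).
  rewrite /eta_root map_block_mx !map_mx0 map_mxN map_mxM map_invmx -map_trmx.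
  by rewrite mul_block_col !mul0mx addr0 add0r mulNmx mulmxA.
have cxE w th : toC I *m col_mx w th = col_mx (JC^T *m w) (- (JC *m th))
    :> 'cV[R[i]]_(m + m).
  rewrite map_block_mx !map_mx0 map_mxN -map_trmx mul_block_col !mul0mx.
  by rewrite addr0 add0r mulNmx.
have Y0E (g : 'rV_d) :
    (g *m Y0)^T = col_mx (g *m N)^T (sr^-1 *: (invmx EC *m (g *m N)^T)).
  rewrite mul_mx_row tr_row_mx mulmxA; congr col_mx.
  by rewrite trmx_mul trmxK -scalemxAl.
have ZP (g : 'rV_d) : (g *m A = e *: g) <-> exists h, g = h *m row_base Z.
  split=> [gA|[h ->]].
    apply/submxP; rewrite eq_row_base; apply/sub_kermxP.
    by rewrite mulmxBr gA mul_mx_scalar subrr.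
  have /sub_kermxP : (h *m row_base Z <= Z)%MS by rewrite mulmx_sub // eq_row_base.
  by rewrite mulmxBr mul_mx_scalar => /eqP; rewrite subr_eq0 => /eqP.
move=> v; split=> [[vsig vI]|[h ->]].
  move: vsig vI; rewrite -[v]vsubmxK; move: (usubmx v) (dsubmx v) => w th vsig vI.
  have wF a : w^T *m map_mx ratr (etahat a) = sigma (vsval a) *: w^T.
    have := vsig (vsval a); rewrite etaFF actVE scale_col_mx => /eq_col_mx[wa _].
    by apply: trmx_inj; rewrite trmx_mul trmxK wa linearZ /= trmxK.
  have wN := NW _ _ wF.
  have thE : th = sr^-1 *: (invmx EC *m w).
    have := vsig r; rewrite etarr rootE scale_col_mx => /eq_col_mx[_ ->].
    by rewrite scalerA mulVf // scale1r.
  have wJ : w^T *m JC = e *: w^T.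
    move: vI; rewrite cxE scale_col_mx => /eq_col_mx[wJ _].
    by apply: trmx_inj; rewrite trmx_mul trmxK wJ linearZ /= trmxK.
  have /ZP[h hE] : w^T *m VC *m A = e *: (w^T *m VC).
    by rewrite /A !mulmxA -wN wJ -scalemxAl.
  by exists h; rewrite mulmxA -hE Y0E -wN trmxK -thE.
have gA : h *m row_base Z *m A = e *: (h *m row_base Z) by apply/ZP; exists h.
rewrite mulmxA; move: (h *m row_base Z) gA => g gA.
rewrite Y0E; set w := (g *m N)^T.
have ECr a : map_mx ratr (etahat a) *m invmx EC
    = invmx EC *m (map_mx ratr (etahat a))^T.
  apply: (can_inj (mulKmx ECu)); rewrite !mulmxA mulmxV // mul1mx.
  by rewrite map_trmx /EC -map_mxM -rosati map_mxM -mulmxA mulmxV // mulmx1.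
have wF a : (map_mx ratr (etahat a))^T *m w = sigma (vsval a) *: w by apply: fT.
have wJ : JC^T *m w = e *: w.
  by rewrite -trmx_mul -mulmxA NJ mulmxA gA -scalemxAl linearZ.
have vF a : map_mx ratr (actV (etahat a)) *m col_mx w (sr^-1 *: (invmx EC *m w))
    = sigma (vsval a) *: col_mx w (sr^-1 *: (invmx EC *m w)).
  rewrite actVE wF scale_col_mx -scalemxAr mulmxA ECr -mulmxA wF -scalemxAr.
  by rewrite !scalerA mulrC.
split=> [t|].
  have [a [b ->]] := Fadjoin_sqrt r2 r_gen t.
  rewrite etaEE map_mxD map_mxM mulmxDl vF -mulmxA rootE.
  rewrite -[EC *m _]scalemxAr [EC *m _]mulmxA mulmxV // mul1mx -scalemxAr wF.
  have -> : col_mx (- (sr^-1 *: (sigma (vsval q) *: w))) (invmx EC *m w)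
      = sr *: col_mx w (sr^-1 *: (invmx EC *m w)).
    rewrite scale_col_mx !scalerA divff // scale1r -scaleNr -mulrN -sr2.
    by rewrite expr2 mulrA mulVf // mul1r.
  by rewrite -scalemxAr vF scalerA -scalerDl rmorphD rmorphM [sr * _]mulrC.
rewrite cxE wJ scale_col_mx -scalemxAr mulmxA JCE mulNmx scalerN opprK -mulmxA wJ.
by rewrite -scalemxAr !scalerA mulrC.
Qed.

Lemma balanced_cx : balanced_eigenspaces eta d I.
Proof.
move=> sigma; split; apply: eigenspace_dim.
- exact: sqr_i.
- by apply/eqP; rewrite eq_complex /= oppr0 !eqxx.
- by rewrite sqrrN; exact: sqr_i.
- by rewrite rmorphN; congr (- _); apply/eqP; rewrite eq_complex /= oppr0 !eqxx.
Qed.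
End BalancedEigenspaces.

(** * Split type and the theorem *)

Lemma field_trace1 (L : fieldExtType rat) : field_trace (1 : L) != 0.
Proof.
rewrite /field_trace (eq_bigr (fun=> 1)) => [|i _].
  by rewrite sumr_const card_ord pnatr_eq0 -lt0n adim_gt0.
by rewrite mul1r coord_free ?eqxx // (basis_free (vbasisP _)).
Qed.

Section SplitType.
Variables (m d : nat) (Theta : 'M[rat]_m).
Variables (K : fieldExtType rat) (F : {subfield K}).
Variable etahat : {rmorphism subvs_of F -> 'M[rat]_m}.
Variables (q : subvs_of F) (r : K) (eta : K -> 'M[rat]_(m + m)).
Hypothesis m_dim : m = (d * \dim {: subvs_of F})%N.
Hypothesis Theta_skew : Theta^T = - Theta.
Hypothesis Theta_unit : Theta \in unitmx.
Hypothesis r2 : r ^+ 2 = - vsval q.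
Hypothesis r_gen : <<F; r>>%VS = {:K}%VS.
Hypothesis q0 : q != 0.
Hypothesis rosati : forall a, (etahat a)^T *m Theta = Theta *m etahat a.
Hypothesis etaP : is_eta etahat q Theta r eta.
Variable bF : 'cV[rat]_(m + m) -> 'cV[rat]_(m + m) -> subvs_of F.
Hypothesis bFP : is_Fform etahat bF.

Let etaKK := etaK r2 r_gen q0 Theta_skew Theta_unit rosati etaP.
Let etaMM := etaM r2 r_gen q0 Theta_skew Theta_unit rosati etaP.
Let etaFF := eta_F q0 Theta_skew Theta_unit rosati etaP.

Lemma isotropic_comb k (u : 'I_k -> 'cV[rat]_m) (x y : {ffun 'I_k -> subvs_of F}) :
  isotropic etahat Theta u -> (comb etahat u x)^T *m Theta *m comb etahat u y = 0.
Proof.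
move=> u_iso; rewrite /comb mulmx_sumr big1 // => j _.
rewrite [(\sum_i _)^T]linear_sum !mulmx_suml big1 // => i _ /=.
rewrite trmx_mul -[_ *m _ *m Theta]mulmxA rosati.
by rewrite -!mulmxA [etahat _ *m (_ *m _)]mulmxA mulmxE -rmorphM mulmxA u_iso.
Qed.

(** The K-span of the vectors (0, u i), for an F-Lagrangian family u, is stable
    under eta K; so it is enough that the pairing of V vanishes on it: if bF
    took a nonzero value z there, then it would also take the value 1, whose
    trace is not 0. *)
Lemma split_type_of_isotropic t : split_type eta bF d t.
Proof.
have [|u [u_free u_iso]] :=
  @exists_isotropic _ m etahat d m_dim Theta Theta_skew rosati d./2.
  by rewrite -[X in (_ <= X)%N]odd_double_half leq_addl.
pose U i : 'cV[rat]_(m + m) := col_mx 0 (u i).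
(* With c i = x i + y i r, the r-part of K moves the span of u into H^1(X, Q). *)
have KcombE c : exists x y : {ffun 'I_(d./2) -> subvs_of F},
    (forall i, c i = vsval (x i) + vsval (y i) * r) /\
    Kcomb eta U c = col_mx (- (Theta *m (etahat q *m comb etahat u y)))
                           (comb etahat u x).
  have [x xP] := fin_all_exists (fun i => etaKK (c i)).
  have [y yP] := fin_all_exists xP.
  exists (finfun x), (finfun y); split=> [i|]; first by rewrite !ffunE (yP i).1.
  rewrite /Kcomb /comb.
  rewrite (eq_bigr (fun i => col_mx (- (Theta *m (etahat q *m (etahat (y i) *m u i))))
                            (etahat (x i) *m u i))) => [|i _]; last first.
    rewrite (yP i).2 mulmxDl -mulmxA /U /eta_root /actV !mul_block_col.
    rewrite !(mulmx0, mul0mx, add0r, addr0) add_col_mx !(add0r, addr0) mulNmx mulmxN.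
    congr (col_mx (- _) _); rewrite !mulmxA -rosati; congr (_ *m _).
    by rewrite -[RHS]mulmxA -rosati mulmxA -!trmx_mul rmorph_mulmxC.
  rewrite -[LHS]vsubmxK !linear_sum /=; congr col_mx.
    by apply: eq_bigr => i _; rewrite col_mxKu ffunE.
  by apply: eq_bigr => i _; rewrite col_mxKd ffunE.
have pair0 c c' : pairV (Kcomb eta U c) (Kcomb eta U c') = 0.
  have [x [y [_ ->]]] := KcombE c; have [x' [y' [_ ->]]] := KcombE c'.
  rewrite /pairV !col_mxKu !col_mxKd !mulmxN -!comb_mul !mulmxA !isotropic_comb //.
  by rewrite oppr0 addr0 mxE.
have etaKcomb a c : eta a *m Kcomb eta U c = Kcomb eta U (fun i => a * c i).
  by rewrite /Kcomb mulmx_sumr; apply: eq_bigr => i _; rewrite etaMM mulmxA.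
have [_ bFlin bFtr] := bFP.
have bF0 c c' : bF (Kcomb eta U c) (Kcomb eta U c') = 0.
  apply/eqP; apply: contraT => z0; set z := bF _ _ in z0.
  have bF00 y : bF 0 y = 0.
    have := bFlin 0 0 0 y; rewrite mulmx0 addr0 mul0r add0r => _.
    have := bFlin 1 0 0 y; rewrite mulmx0 addr0 mul1r => /eqP.
    by rewrite -subr_eq0 opprD addrA subrr add0r oppr_eq0 => /eqP.
  have := bFlin z^-1 (Kcomb eta U c) 0 (Kcomb eta U c').
  rewrite addr0 bF00 addr0 -/z mulVf // -etaFF etaKcomb => bF1.
  by have := field_trace1 (subvs_of F); rewrite -bF1 bFtr pair0 eqxx.
exists U => [c|c c']; last first.
  by rewrite /Hform etaKcomb !bF0 linear0 !mulr0 addr0.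
have [x [y [cE ->]]] := KcombE c; rewrite -[0]col_mx0 => /eq_col_mx[/eqP + /u_free x0].
rewrite oppr_eq0 => /eqP/(congr1 (mulmx (invmx Theta))).
rewrite mulKmx // mulmx0 -comb_mul => /u_free/ffunP y0 i.
rewrite cE x0 ffunE linear0 add0r.
have := y0 i; rewrite !ffunE => /eqP; rewrite mulf_eq0 (negPf q0) => /eqP->.
by rewrite linear0 mul0r.
Qed.
End SplitType.

Section SpinLift.
Variables (R : realType) (m h : nat) (J : 'M[R]_m) (Theta : 'M[rat]_m).
Hypothesis m_even : ~~ odd m.
Hypothesis JJ : J *m J = - 1%:M.
Hypothesis ThetaP : is_polarization J Theta.
Variables (K : fieldExtType rat) (F : {subfield K}).
Variable etahat : subvs_of F -> 'M[rat]_m.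
Hypothesis J_etahat : forall a,
  map_mx ratr (etahat a) *m J = J *m map_mx ratr (etahat a).
Variables (r : K) (s : 'I_h -> {rmorphism subvs_of F -> R}).
Hypothesis s_inj : forall i j, s i =1 s j -> i = j.
Variable Thetas : 'I_h -> ext R m.
Hypothesis ThetasP : is_decomposition etahat Theta s Thetas.
Variable B : {vspace ext rat m}.
Hypothesis BP : is_B r s Thetas B.

Lemma cx_in_rho_Spin_B : in_rho_Spin_B B (block_mx J^T 0 0 (- J)).
Proof.
have JTJT : J^T *m J^T = - 1%:M by rewrite -trmx_mul JJ linearN /= trmx1.
have [Tsk JEJ _] := ThetaP.
exists (ext_lfun J^T).
  apply: is_spin_ext_map; last exact: spinor_norm_complex_structure.
  by rewrite linearN /= mulNmx JTJT opprK.
move=> b bB; rewrite ext_lfunE; apply: (ext_map_B BP) => // i.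
apply: (ext_map_component s_inj ThetasP Tsk) => [a|]; last by rewrite trmxK.
by rewrite -!trmx_mul J_etahat.
Qed.
End SpinLift.

Theorem lemma11p1p2 (R : realType)
    (K : fieldExtType rat) (F : {subfield K}) (iota : {rmorphism K -> K})
    (hK : is_CM R F iota)
    (d n : nat) (d_gt0 : (0 < d)%N) (d_even : ~~ odd d)
    (hn : (4 * n = d * \dim {:K})%N)
    (X : abelian_variety R n) (X_simple : is_simple X)
    (etahat : {rmorphism subvs_of F -> 'M[rat]_(n.*2)})
    (etahat_inj : injective etahat)
    (etahat_im : forall M, is_Qendo X M <-> exists a, etahat a = M)
    (bF : 'cV[rat]_(n.*2 + n.*2) -> 'cV[rat]_(n.*2 + n.*2) -> subvs_of F)
    (hbF : is_Fform etahat bF)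
    (Theta : 'M[rat]_(n.*2)) (hTheta : is_polarization (cx_str X) Theta)
    (q : subvs_of F) (r : K) (r_sqr : r ^+ 2 = - vsval q)
    (r_minus : iota r = - r) (r_gen : <<F; r>>%VS = {:K}%VS)
    (eta : K -> 'M[rat]_(n.*2 + n.*2)) (heta : is_eta etahat q Theta r eta)
    (h : nat) (s : 'I_h -> {rmorphism subvs_of F -> R})
    (hs : enumerates_embeddings s)
    (Thetas : 'I_h -> ext R n.*2)
    (hThetas : is_decomposition etahat Theta s Thetas)
    (B : {vspace ext rat n.*2}) (hB : is_B r s Thetas B) :
  exists t : K,
    [/\ t <> 0, iota t = - t,
        in_Omega eta d B t (cx_XXdual X),
        polarized_Weil_type eta iota d t (cx_XXdual X)
      & split_type eta bF d t].
Proof.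
have [F_real K_im K_quad iotaF [x0 iota_x0]] := hK.
have r0 : r != 0.
  apply/eqP => r0; case: iota_x0; have [a [b ->]] := Fadjoin_sqrt r_sqr r_gen x0.
  by rewrite r0 mulr0 addr0 iotaF // subvsP.
have q0 : q != 0.
  apply: contraNneq r0 => q0; have /eqP := r_sqr.
  by rewrite q0 rmorph0 oppr0 sqrf_eq0.
have m_gt0 : (0 < n.*2)%N by rewrite double_gt0; case: X_simple.
have m_dim : n.*2 = (d * \dim {: subvs_of F})%N.
  have FK : \dim {:K} = (2 * \dim F)%N.
    have K2 : \dim_F {:K} = 2%N := K_quad.
    by rewrite -K2 -dim_sup_field ?subvf.
  have -> : \dim {: subvs_of F} = \dim F by rewrite dimvf.
  by apply: double_inj; rewrite -!mul2n mulnA hn FK mulnCA.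
have JJ := cx_str_sqr X.
have J_etahat a : map_mx ratr (etahat a) *m cx_str X = cx_str X *m map_mx ratr (etahat a).
  by apply/etahat_im; exists a.
have rosati := rosati_trivial JJ hTheta F_real etahat_im m_gt0.
have m_even : ~~ odd n.*2 by rewrite odd_double.
have [Tsk _ _] := hTheta.
have Tu := Theta_unit hTheta.
have bal := balanced_cx JJ hTheta m_dim F_real r_sqr r_gen q0 J_etahat rosati heta.
have pos := Xi_positive_cx JJ hTheta F_real K_im r_sqr r_gen q0 J_etahat rosati heta.
exists (- r); split.
- by apply/eqP; rewrite oppr_eq0.
- by rewrite rmorphN r_minus.
- split=> //; last exact: cx_sqr.
  exact: (cx_in_rho_Spin_B m_even JJ hTheta J_etahat hs.1 hThetas hB).
- split=> //.
  + exact: (eta_cx JJ hTheta r_sqr r_gen q0 J_etahat rosati heta).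
  + exact: (Xi_skew hTheta r_sqr r_gen q0 rosati heta).
  + split=> //; exact: (Xi_cx JJ hTheta r_sqr r_gen q0 J_etahat rosati heta).
  + exact: (Xi_rosati hTheta r_sqr r_gen q0 rosati heta iotaF r_minus).
- exact: (split_type_of_isotropic m_dim Tsk Tu r_sqr r_gen q0 rosati heta hbF).
Qed.
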